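(* Let $\boldsymbol T=(T_1,\ldots,T_d)$ be a commuting tuple of operators on a complex separable Hilbert space $\mathcal H$. Assume that $\boldsymbol T$ is in the class $BS_{m,\vartheta}(\Omega)$. Then the determinant operator $\mathrm{dEt}\big([\![\boldsymbol T^*,\boldsymbol T]\!]\big)$ is in trace class and $$\mathrm{trace}\,\Big(\mathrm{dEt}\big([\![\boldsymbol T^*,\boldsymbol T]\!]\big)\Big)\le m\,\vartheta\,d!\,\prod_{i=1}^d\|T_i\|^2.$$
   Context: All operators are bounded and linear; $[A,B]:=AB-BA$; $\mathfrak S_d$ is the permutation group on $d$ symbols. $[\![\boldsymbol T^*,\boldsymbol T]\!]$ is the $d\times d$ block operator with $(i,j)$ entry $B_{ij}=[T_j^*,T_i]$, and $$\mathrm{dEt}\big([\![\boldsymbol T^*,\boldsymbol T]\!]\big):=\sum_{\sigma,\tau\in\mathfrak S_d}\mathrm{Sgn}(\sigma)\,B_{\tau(1),\sigma(\tau(1))}B_{\tau(2),\sigma(\tau(2))}\cdots B_{\tau(d),\sigma(\tau(d))}.$$ A commuting $d$-tuple $\boldsymbol T$ is $m$-cyclic if $m$ is the smallest cardinality of a linearly independent set $\boldsymbol\xi\subseteq\mathcal H$ such that $\mathcal H$ is the closed linear span of $\{T_1^{i_1}\cdots T_d^{i_d}v: v\in\boldsymbol\xi,\ i_1,\ldots,i_d\ge 0\}$; $\boldsymbol\xi[m]$ denotes such a set of $m$ linearly independent vectors. For $N\in\mathbb N_0$, $\mathcal H_N$ is the linear span of $\{T_1^{i_1}\cdots T_d^{i_d}v: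 v\in\boldsymbol\xi[m],\ 0\le i_1+\cdots+i_d\le N\}$, $P_N$ is the orthogonal projection onto $\mathcal H_N$, and $P_N^\perp=I-P_N$. Let $\Omega\subset\mathbb C^d$ be a bounded domain such that $\overline\Omega$ is polynomially convex. An $m$-cyclic commuting $d$-tuple $\boldsymbol T$ with Taylor joint spectrum $\sigma(\boldsymbol T)=\overline\Omega$ is in the class $BS_{m,\vartheta}(\Omega)$, $\vartheta\in\mathbb N$, if (i) $P_NT_jP_N^\perp=0$ for $j=1,\ldots,d$ (and all $N$); (ii) $\mathrm{dEt}\big([\![\boldsymbol T^*,\boldsymbol T]\!]\big)$ is non-negative definite; (iii) for every $\tau\in\mathfrak S_d$ and every $N$ (with $\vartheta$ independent of $N$), $$\Big\|P_N\Big(\sum_{\eta\in\mathfrak S_d}\mathrm{Sgn}(\eta)\,T^*_{\eta(1)}T_{\tau(1)}T^*_{\eta(2)}T_{\tau(2)}\cdots T_{\tau(d-1)}T^*_{\eta(d)}\Big)P_N^\perp T_{\tau(d)}P_N\Big\|\le\vartheta\,\binom{N+d-1}{d-1}^{-1}\prod_{i=1}^d\|T_i\|^2.$$ *)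

(* Defs.v *)
From HB Require Import structures.
From mathcomp Require Export all_boot all_order all_algebra all_fingroup.
From mathcomp Require Export all_classical all_reals all_analysis.
From mathcomp Require Export complex.
From mathcomp Require mpoly.
Set Implicit Arguments.
Unset Strict Implicit.
Unset Printing Implicit Defensive.
Import Order.TTheory GRing.Theory Num.Theory.
Import numFieldNormedType.Exports.

Local Open Scope classical_set_scope.
Local Open Scope ring_scope.
Local Open Scope complex_scope.

(* A complex Hilbert space: a complete normed space over R[i] whose norm comes
   from an inner product, linear in its first argument. *)
HB.mixin Record NormedModule_isHilbert (R : realType) H
    of CompleteNormedModule R[i] H := {
  hdot : H -> H -> R[i];
  hdotDl : forall x y z, hdot (x + y) z = hdot x z + hdot y z;
  hdotZl : forall (a : R[i]) x y, hdot (a *: x) y = a * hdot x y;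
  hdotC : forall x y, hdot y x = (hdot x y)^*;
  hdot_norm : forall x, hdot x x = `|x| ^+ 2
}.

#[short(type="hilbertType")]
HB.structure Definition Hilbert (R : realType) :=
  {H of CompleteNormedModule R[i] H & NormedModule_isHilbert R H}.

Definition separable_space (X : topologicalType) : Prop :=
  exists D : set X, countable D /\ dense D.

(* Norms over R[i] are R[i]-valued (with null imaginary part); [rnorm] is the
   same norm with values in R. *)
Definition rnorm (R : realType) (V : normedModType R[i]) (x : V) : R :=
  complex.Re `|x|.

Section Operators.
Variables (R : realType) (H : hilbertType R).
Implicit Types (A B P : H -> H) (V E : set H).

Definition bounded_operator A : Prop := linear A /\ continuous A.

Definition opnorm A : R := sup [set rnorm (A x) | x in [set x : H | rnorm x <= 1]].

(* By the Riesz theorem, [adj A y] is the only z such that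
   <A x, y> = <x, z> for every x, whenever A is a bounded operator. *)
Definition adj A (y : H) : H :=
  xget 0 [set z | forall x, hdot (A x) y = hdot x z].

Definition commutator A B (x : H) : H := A (B x) - B (A x).

Definition nonneg_operator A : Prop := forall x, 0 <= hdot (A x) x.

(* The value at x is the only v in V with x - v orthogonal to V, provided that V
   is a closed subspace. *)
Definition orthproj V (x : H) : H :=
  xget 0 [set v | V v /\ forall w, V w -> hdot (x - v) w = 0].

Definition linspan V : set H :=
  [set x | exists (n : nat) (v : 'I_n -> H) (c : 'I_n -> R[i]),
             (forall i, V (v i)) /\ x = \sum_(i < n) c i *: v i].

Definition linearly_independent m (xi : 'I_m -> H) : Prop :=
  forall c : 'I_m -> R[i],
    \sum_(i < m) c i *: xi i = 0 -> forall i, c i = 0.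

Definition orthonormal_basis E : Prop :=
  [/\ forall e, E e -> hdot e e = 1,
      forall e f, E e -> E f -> e <> f -> hdot e f = 0 &
      closure (linspan E) = setT].

(* P = |A|, the square root of A^* A. *)
Definition is_abs_operator A P : Prop :=
  [/\ bounded_operator P, nonneg_operator P &
      forall x, P (P x) = adj A (A x)].

Definition trace_class A : Prop :=
  bounded_operator A /\
  exists P, is_abs_operator A P /\
    forall E, orthonormal_basis E ->
      (\esum_(e in E) (complex.Re (hdot (P e) e))%:E < +oo)%E.

(* Unordered summation of the family (f e), e in E. *)
Definition has_sum E (f : H -> R[i]) (s : R[i]) : Prop :=
  forall eps : R[i], 0 < eps ->
    exists F0 : set H, [/\ finite_set F0, F0 `<=` E &
      forall F : set H, finite_set F -> F `<=` E -> F0 `<=` F ->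
        `|\sum_(e \in F) f e - s| < eps].

(* The sum of <A e, e> over an orthonormal basis; for trace class operators it
   exists and is the same for all bases. *)
Definition trace A : R[i] :=
  xget 0 [set t | forall E, orthonormal_basis E ->
                    has_sum E (fun e => hdot (A e) e) t].

Definition opprod d (A : 'I_d -> H -> H) : H -> H :=
  \big[(fun f g : H -> H => f \o g)/id]_(i < d) A i.

End Operators.

(* Points of C^d are row vectors over (R[i])^o, the copy of R[i] that carries the
   topology of its norm. *)
Section Tuples.
Variables (R : realType) (H : hilbertType R) (d : nat).
Implicit Types (T : 'I_d -> H -> H) (s t : 'S_d).

Definition commuting T : Prop := forall i j x, T i (T j x) = T j (T i x).

Definition commutator_block T (i j : 'I_d) : H -> H :=
  commutator (adj (T j)) (T i).

Definition dEt (B : 'I_d -> 'I_d -> H -> H) (x : H) : H :=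
  \sum_(s : 'S_d) \sum_(t : 'S_d)
    (-1) ^+ s *: opprod (fun i => B (t i) (s (t i))) x.

(* The Koszul differential of a tuple A on the exterior algebra over C^d with
   coefficients in H: f stands for the sum of the f S (x) e_S, and the
   differential is the sum of the A i (x) (e_i /\ -). For i in S,
   e_i /\ e_(S \ i) = (-1)^#{j in S | j < i} e_S. *)
Definition koszul (A : 'I_d -> H -> H) (f : {set 'I_d} -> H)
    (S : {set 'I_d}) : H :=
  \sum_(i in S) (-1) ^+ #|[set j in S | (j < i)%N]| *: A i (f (S :\ i)%SET).

Definition koszul_exact (A : 'I_d -> H -> H) : Prop :=
  forall f : {set 'I_d} -> H,
    koszul A f = (fun=> 0) <-> exists g, f = koszul A g.

Definition taylor_spectrum T : set 'rV[(R[i])^o]_d :=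
  [set z : 'rV[(R[i])^o]_d | ~ koszul_exact (fun i x => T i x - z 0 i *: x)].

Definition monomial T (a : 'I_d -> nat) : H -> H :=
  opprod (fun i => iter (a i) (T i)).

Definition cyclic_family T m (xi : 'I_m -> H) : Prop :=
  linearly_independent xi /\
  closure (linspan [set monomial T a (xi k) | a in setT & k in setT]) = setT.

Definition m_cyclic T (m : nat) : Prop :=
  (exists xi : 'I_m -> H, cyclic_family T xi) /\
  forall k (xi : 'I_k -> H), cyclic_family T xi -> (m <= k)%N.

Definition filtration T m (xi : 'I_m -> H) (N : nat) : set H :=
  linspan [set monomial T a (xi k) |
             a in [set a | (\sum_i a i <= N)%N] & k in setT].

(* sum over eta of Sgn(eta) T*_eta(1) T_tau(1) T*_eta(2) ... T_tau(d-1) T*_eta(d);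
   no T_tau(d) after the last adjoint. *)
Definition alternating_word T (tau : 'S_d) (x : H) : H :=
  \sum_(eta : 'S_d)
    (-1) ^+ eta *:
      opprod (fun i : 'I_d => adj (T (eta i)) \o
                (if i.+1 == d then id else T (tau i))) x.

(* The commutativity of T, and the requirement that Omega is a bounded domain with
   polynomially convex closure, are left to the statements that use the class. *)
Definition BS_class (m vartheta : nat) (Omega : set 'rV[(R[i])^o]_d) T : Prop :=
  [/\ (0 < vartheta)%N, m_cyclic T m, taylor_spectrum T = closure Omega &
   exists xi : 'I_m -> H,
     let P N := orthproj (filtration T xi N) in
     let Pperp N (x : H) := x - P N x in
     [/\ cyclic_family T xi,
         forall N j (x : H), P N (T j (Pperp N x)) = 0,
         nonneg_operator (dEt (commutator_block T)) &
         forall (tau : 'S_d) (N : nat) (last : 'I_d), last.+1 = d ->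
           opnorm (P N \o alternating_word T tau \o Pperp N
                     \o T (tau last) \o P N)
           <= vartheta%:R * 'C((N + d).-1, d.-1)%:R^-1
                * \prod_(i < d) opnorm (T i) ^+ 2]].

End Tuples.

Section Domains.
Variables (R : realType) (d : nat).
Implicit Types (K Omega : set 'rV[(R[i])^o]_d).

Definition cabs (z : R[i]) : R := complex.Re `|z|.

Definition polynomial_hull K : set 'rV[(R[i])^o]_d :=
  [set z : 'rV[(R[i])^o]_d | forall p : mpoly.mpoly d R[i],
     cabs (mpoly.meval (fun i => z 0 i) p)
       <= sup [set cabs (mpoly.meval (fun i => w 0 i) p) | w in K]].

Definition polynomially_convex K : Prop := polynomial_hull K = K.

Definition bounded_domain Omega : Prop :=
  [/\ open Omega, connected Omega, Omega !=set0 &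
      exists M : R, forall z i, Omega z -> cabs (z 0 i) <= M].

End Domains.

(* Main.v *)
From HB Require Import structures.
Require Import Defs.
From mathcomp Require Import finmap lra ring.
Set Implicit Arguments.
Unset Strict Implicit.
Unset Printing Implicit Defensive.
Import Order.TTheory GRing.Theory Num.Theory.
Import numFieldNormedType.Exports.
Local Open Scope classical_set_scope.
Local Open Scope ring_scope.
Local Open Scope complex_scope.

(** Antisymmetrizing a product of commutators [adj (T j), T i] over both families
    of indices kills every word in which two letters T, or two letters adj T, are
    neighbours, since letters of one kind commute.  Of the 2^d words of the
    expansion only the two alternating ones survive, and moving the first letter of
    the second one to the end by a cyclic shift gives
      dEt = sum over t of sgn(t) [W_t, T_t(d)],
    where W_t is the alternating word whose compressions are estimated in the
    definition of the class (sum_alt_commutators, dEt_alternating_word).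

    The trace of a commutator compressed to the finite-dimensional space H_N is not
    zero only because the compression P_N is not multiplicative.  Since
    P_N T (1 - P_N) = 0, the defect is the trace of P_N W (1 - P_N) T P_N.  Each T_j
    maps H_(N-1) into H_N, so that this operator kills H_(N-1); only an orthonormal
    basis of the orthogonal complement of H_(N-1) in H_N contributes.  It has at
    most m binom(N+d-1,d-1) elements, as many as there are monomials of degree N
    applied to the m cyclic vectors, and the class bounds each contribution by
    vartheta binom(N+d-1,d-1)^-1 prod ||T_i||^2 (trace_compressed_commutator).  The
    binomial coefficients cancel, and summation over t gives a bound for the trace
    of P_N dEt P_N that does not depend on N.

    It remains to let N grow.  As dEt is nonnegative it is selfadjoint and equal to
    its absolute value, and the sum of its diagonal coefficients over any finite
    orthonormal family compressed to H_N is at most the trace of its compression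
    (compression_trace_le); the vectors of the family are approximated by their
    projections because the union of the H_N is dense (orthonormal_trace_le).  The
    uniform bound then holds for all finite orthonormal families, which is both
    trace class membership and the trace inequality (nonneg_trace_class_le).

    Adjoints exist by the Riesz theorem (riesz), and the projections P_N are made
    explicit by the Gram-Schmidt process applied to the monomials in order of
    increasing degree, so that an orthonormal basis of H_N extends one of H_(N-1). *)

(** * Antisymmetrized products of commutators *)

Section Alternating.
Variable A : pzRingType.

(** Localizes the effect that transposing two consecutive indices has on a
    noncommutative product. *)
Lemma eq_prod_adjacent n (F G : 'I_n -> A) (k k' : 'I_n) :
  k' = k.+1 :> nat -> F k * F k' = G k * G k' ->
  (forall i, i != k -> i != k' -> F i = G i) -> \prod_i F i = \prod_i G i.
Proof.
elim: n F G k k' => [|n IH] F G k k' kk' e2 e; first by case: k kk' e2 e.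
case: (unliftP ord0 k) => [k1|] k_eq; last first.
  case: n F G k k' k_eq kk' e2 e {IH} => [|n] F G k k' k_eq kk' e2 e.
    by move: (ltn_ord k'); rewrite kk' k_eq.
  have k'_eq : k' = lift ord0 ord0 by apply: val_inj; rewrite /= kk' k_eq.
  rewrite !big_ord_recl !mulrA -k'_eq -k_eq e2; congr (_ * _).
  by apply: eq_bigr => i _; apply: e; rewrite ?k_eq ?k'_eq -?val_eqE.
case: (unliftP ord0 k') => [k1'|] k_eq'; last by rewrite k_eq' k_eq in kk'.
rewrite !big_ord_recl; congr (_ * _).
  by apply: e; rewrite ?k_eq ?k_eq' neq_lift.
apply: (IH _ _ k1 k1').
- by move: kk'; rewrite k_eq k_eq' /= /bump /= !add1n => -[].
- by rewrite -k_eq -k_eq'.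
by move=> i n1 n2; apply: e; rewrite ?k_eq ?k_eq' (inj_eq lift_inj).
Qed.

(** Composition with a transposition pairs the permutations of opposite signs. *)
Lemma sum_perm_alt_eq0 n (F : 'S_n -> A) (k k' : 'I_n) :
  k != k' -> (forall s, F (tperm k k' * s)%g = F s) ->
  \sum_(s : 'S_n) (-1) ^+ s * F s = 0.
Proof.
move=> kk' inv; rewrite (bigID (@odd_perm _)) /=.
rewrite (reindex_inj (mulgI (tperm k k'))) /=.
rewrite (eq_bigr (fun s : 'S_n => - F s)); last first.
  by move=> s; rewrite odd_permM odd_tperm kk' inv => /= ->; rewrite expr1 mulN1r.
rewrite (eq_bigl (fun s : 'S_n => ~~ odd_perm s)); last first.
  by move=> s; rewrite odd_permM odd_tperm kk'.
rewrite sumrN addrC; apply/eqP; rewrite subr_eq0; apply/eqP.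
by apply: eq_bigr => s /negPf ->; rewrite expr0 mul1r.
Qed.

Lemma nonconstant_adjacent n (f : 'I_n.+1 -> bool) :
  (forall k k' : 'I_n.+1, k' = k.+1 :> nat -> f k = f k') ->
  forall k, f k = f ord0.
Proof.
move=> adj [k]; elim: k => [|k IH] lt_k; first by congr f; apply: val_inj.
by rewrite -(IH (ltnW lt_k)); apply/esym/adj.
Qed.

(** The antisymmetrized word x y x y ... y x: it has one letter y fewer than it has
    letters x, whence the 1 in the last factor. *)
Definition alt_word n (x y : 'I_n -> A) (t : 'S_n) : A :=
  \sum_(eta : 'S_n)
     (-1) ^+ eta * \prod_i (x (eta i) * (if i.+1 == n then 1 else y (t i))).

Lemma sum_alt_word_mulr n (x y : 'I_n.+1 -> A) :
  \sum_(t : 'S_n.+1) \sum_(u : 'S_n.+1)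
     (-1) ^+ t * ((-1) ^+ u * \prod_i (x (u i) * y (t i)))
  = \sum_(t : 'S_n.+1) (-1) ^+ t * (alt_word x y t * y (t ord_max)).
Proof.
apply: eq_bigr => t _; rewrite -mulr_sumr; congr (_ * _).
rewrite mulr_suml; apply: eq_bigr => u _; rewrite -mulrA; congr (_ * _).
rewrite !big_ord_recr /= eqxx mulr1 !mulrA; congr (_ * _ * _).
apply: eq_bigr => i _; by rewrite eqSS ltn_eqF.
Qed.

(** Here each word starts with the letter y that alt_word lacks at its end.  The
    cyclic shift moves this letter to the last place; its sign (-1)^n and the sign
    (-1)^(n+1) of the n+1 negated factors leave the single minus sign. *)
Lemma sum_alt_word_mull n (x y : 'I_n.+1 -> A) :
  \sum_(t : 'S_n.+1) \sum_(u : 'S_n.+1)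
     (-1) ^+ t * ((-1) ^+ u * \prod_i (- (y (t i) * x (u i))))
  = - \sum_(t : 'S_n.+1) (-1) ^+ t * (y (t ord_max) * alt_word x y t).
Proof.
(* c is the cyclic shift i |-> i + 1 *)
pose c : 'S_n.+1 := lift_perm ord_max ord0 1%g.
have c_max : c ord_max = ord0 by rewrite lift_perm_id.
have c_lift i : c (lift ord_max i) = lift ord0 i by rewrite lift_perm_lift perm1.
rewrite [in RHS](reindex_inj (mulgI c)) -sumrN /=; apply: eq_bigr => t _.
rewrite /alt_word !mulr_sumr -sumrN; apply: eq_bigr => u _.
rewrite permM c_max odd_permM odd_lift_perm odd_perm1 /= addbF addbF.
rewrite prodrN cardT size_enum_ord (signr_addb _ (odd n)) (signr_odd _ n).
rewrite big_ord_recl big_ord_recr /= eqxx mulr1.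
set p := \prod_(i < n) _; have -> :
  \prod_(i < n) (x (u (widen_ord (leqnSn n) i)) *
     (if i.+1 == n.+1 then 1 else y ((c * t)%g (widen_ord (leqnSn n) i))))
     * x (u ord_max)
  = x (u ord0) * p.
  have -> : p = \prod_(i < n) (y (t (lift ord0 i)) * x (u (lift ord0 i))) by [].
  transitivity (\prod_(i < n) (x (u (widen_ord (leqnSn n) i)) * y (t (lift ord0 i)))
                 * x (u ord_max)).
    congr (_ * _); apply: eq_bigr => i _; rewrite eqSS ltn_eqF //= permM.
    have -> : widen_ord (leqnSn n) i = lift ord_max i.
      by apply: val_inj; rewrite /= /bump leqNgt ltn_ord.
    by rewrite c_lift.
  clear p.
  have shift k (a b : 'I_k.+1 -> A) :
    \prod_(i < k) (a (widen_ord (leqnSn k) i) * b (lift ord0 i)) * a ord_max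
    = a ord0 * \prod_(i < k) (b (lift ord0 i) * a (lift ord0 i)).
    elim: k a b => [|k IH] a b.
      by rewrite !big_ord0 mulr1 mul1r; congr a; apply: val_inj.
    rewrite big_ord_recl [in RHS]big_ord_recl /= -mulrA.
    have := IH (fun i => a (lift ord0 i)) (fun i => b (lift ord0 i)).
    have -> : lift ord0 ord_max = ord_max :> 'I_k.+2 by apply: val_inj.
    rewrite (eq_bigr (fun i : 'I_k => a (widen_ord (leqnSn k.+1) (lift ord0 i))
      * b (lift ord0 (lift ord0 i)))); last first.
      by move=> i _; congr (a _ * _); apply: val_inj.
    move=> ->; rewrite !mulrA; congr (a _ * _ * _ * _).
    by apply: val_inj.
  exact: (shift n (fun i => x (u i)) (fun i => y (t i))).
have e1 : (-1) ^+ n.+1 = - (-1) ^+ n :> A by rewrite exprS mulN1r.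
have sgnC (k : nat) (z : A) : z * (-1) ^+ k = (-1) ^+ k * z.
  by rewrite -signr_odd; case: (odd k); rewrite ?expr1 ?expr0 ?mulr1 ?mul1r ?mulrN1 ?mulN1r.
rewrite e1 !mulNr !mulrN; congr (- _).
by rewrite (mulrA (y _) ((-1) ^+ u)) (sgnC u) !mulrA (sgnC n) !mulrA.
Qed.

(** The commutators expand into words indexed by the choice, for each factor, of
    x y or of - y x.  Where the choice changes from one factor to the next, two
    letters of the same kind become neighbours, and the sum over the corresponding
    permutation vanishes; only the two constant choices remain. *)
Lemma sum_alt_commutators n (x y : 'I_n.+1 -> A) :
  (forall i j, x i * x j = x j * x i) -> (forall i j, y i * y j = y j * y i) ->
  \sum_(s : 'S_n.+1) \sum_(t : 'S_n.+1)
     (-1) ^+ s * \prod_i (x (s (t i)) * y (t i) - y (t i) * x (s (t i)))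
  = \sum_(t : 'S_n.+1) (-1) ^+ t *
      (alt_word x y t * y (t ord_max) - y (t ord_max) * alt_word x y t).
Proof.
move=> xC yC.
pose F (t u : 'S_n.+1) (i : 'I_n.+1) (b : bool) :=
  if b then x (u i) * y (t i) else - (y (t i) * x (u i)).
transitivity (\sum_(t : 'S_n.+1) \sum_(u : 'S_n.+1) (-1) ^+ t * ((-1) ^+ u *
   \sum_(f : {ffun 'I_n.+1 -> bool}) \prod_i F t u i (f i))).
  rewrite exchange_big; apply: eq_bigr => t _.
  rewrite (reindex_inj (mulgI t^-1%g)); apply: eq_bigr => u _.
  rewrite odd_permM odd_permV signr_addb -mulrA; congr (_ * (_ * _)).
  rewrite -bigA_distr_bigA; apply: eq_bigr => i _.
  by rewrite big_bool /F permM permK.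
transitivity (\sum_(f : {ffun 'I_n.+1 -> bool}) \sum_(t : 'S_n.+1) \sum_(u : 'S_n.+1)
    (-1) ^+ t * ((-1) ^+ u * \prod_i F t u i (f i))).
  rewrite [RHS]exchange_big; apply: eq_bigr => t _.
  rewrite [RHS]exchange_big; apply: eq_bigr => u _.
  by rewrite -!mulr_sumr.
have ft : finfun (fun=> false) != finfun (fun=> true) :> {ffun 'I_n.+1 -> bool}.
  by apply/eqP => /ffunP /(_ ord0); rewrite !ffunE.
(* all the choices f but the two constant ones cancel *)
rewrite (bigD1 (finfun (fun=> true))) // (bigD1 (finfun (fun=> false))) //=.
rewrite [X in _ + (_ + X)]big1 ?addr0; last first.
  move=> f /andP[f1 f2].
  have [/forallP adj|] := boolP [forall k : 'I_n.+1, forall k' : 'I_n.+1,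
                (k' == k.+1 :> nat) ==> (f k == f k')].
    have cst : forall k, f k = f ord0.
      apply: nonconstant_adjacent => k k' kk'.
      by have /forallP/(_ k')/implyP h := adj k; apply/eqP/h/eqP.
    case f0: (f ord0) in cst.
      by case/eqP: f1; apply/ffunP => i; rewrite ffunE.
    by case/eqP: f2; apply/ffunP => i; rewrite ffunE.
  move=> /forallPn[k] /forallPn[k'] /[!negb_imply] /andP[/eqP kk' fkk'].
  have kk : k != k' by rewrite -val_eqE /= kk' neq_ltn ltnSn.
  have fix_tperm i : i != k -> i != k' -> tperm k k' i = i.
    by move=> i1 i2; rewrite tpermD // eq_sym.
  (* the change at k makes two letters y neighbours if f k holds, and otherwise
     two letters x *)
  case fk: (f k) in fkk'; case fk': (f k') in fkk' => //.
    rewrite exchange_big big1 // => u _.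
    under eq_bigr do rewrite mulrA -signr_addb addbC signr_addb -mulrA.
    rewrite -mulr_sumr (@sum_perm_alt_eq0 _ _ k k') ?mulr0 // => t.
    apply: (@eq_prod_adjacent _ _ _ k k') => //.
      rewrite fk fk' /F !permM tpermL tpermR !mulrN; congr (- _).
      by rewrite !mulrA -!(mulrA (x _)) yC.
    by move=> i i1 i2; rewrite /F permM fix_tperm.
  rewrite big1 // => t _; rewrite -mulr_sumr (@sum_perm_alt_eq0 _ _ k k') ?mulr0 // => u.
  apply: (@eq_prod_adjacent _ _ _ k k') => //.
    rewrite fk fk' /F !permM tpermL tpermR !mulNr; congr (- _).
    by rewrite !mulrA -!(mulrA (y _)) xC.
  by move=> i i1 i2; rewrite /F permM fix_tperm.
under [in RHS]eq_bigr do rewrite mulrBr.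
rewrite sumrB -sum_alt_word_mulr -sum_alt_word_mull; congr (_ + _);
  apply: eq_bigr => t _; apply: eq_bigr => u _; congr (_ * (_ * _));
  by apply: eq_bigr => i _; rewrite ffunE.
Qed.
End Alternating.

(** * Inner products and positive operators *)

Section LinearMaps.
Variables (K : pzRingType) (V W : lmodType K) (f : V -> W).
Hypothesis lin_f : linear f.

Definition pack_linear : {linear V -> W} :=
  HB.pack f (GRing.isLinear.Build K V W *:%R f lin_f).

Lemma linear_fun0 : f 0 = 0. Proof. exact: (linear0 pack_linear). Qed.
Lemma linear_funD x y : f (x + y) = f x + f y.
Proof. exact: (linearD pack_linear). Qed.
Lemma linear_funB x y : f (x - y) = f x - f y.
Proof. exact: (linearB pack_linear). Qed.
Lemma linear_funZ a x : f (a *: x) = a *: f x.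
Proof. by have := lin_f a x 0; rewrite linear_fun0 !addr0. Qed.
Lemma linear_fun_sum I (r : seq I) (F : I -> V) :
  f (\sum_(i <- r) F i) = \sum_(i <- r) f (F i).
Proof. exact: (linear_sum pack_linear). Qed.
End LinearMaps.

Section Hilbert.
Variables (R : realType) (H : hilbertType R).
Implicit Types (x y z : H) (a : R[i]).

Lemma hdotDr x y z : hdot x (y + z) = hdot x y + hdot x z.
Proof. by rewrite hdotC hdotDl rmorphD /= -!hdotC. Qed.
Lemma hdotZr a x y : hdot x (a *: y) = a^*%C * hdot x y.
Proof. by rewrite hdotC hdotZl rmorphM /= -!hdotC. Qed.
Lemma hdot0l y : hdot 0 y = 0.
Proof. by have := hdotZl 0 0 y; rewrite scale0r mul0r. Qed.
Lemma hdot0r x : hdot x 0 = 0.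
Proof. by rewrite hdotC hdot0l conjc0. Qed.
Lemma hdotNl x y : hdot (- x) y = - hdot x y.
Proof. by rewrite -scaleN1r hdotZl mulN1r. Qed.
Lemma hdotNr x y : hdot x (- y) = - hdot x y.
Proof. by rewrite hdotC hdotNl rmorphN /= -hdotC. Qed.
Lemma hdotBl x y z : hdot (x - y) z = hdot x z - hdot y z.
Proof. by rewrite hdotDl hdotNl. Qed.
Lemma hdotBr x y z : hdot x (y - z) = hdot x y - hdot x z.
Proof. by rewrite hdotDr hdotNr. Qed.
Lemma hdot_suml I (r : seq I) (F : I -> H) y :
  hdot (\sum_(i <- r) F i) y = \sum_(i <- r) hdot (F i) y.
Proof.
by elim: r => [|i r IH]; rewrite ?big_nil ?hdot0l // !big_cons hdotDl IH.
Qed.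
Lemma hdot_sumr I (r : seq I) (F : I -> H) x :
  hdot x (\sum_(i <- r) F i) = \sum_(i <- r) hdot x (F i).
Proof.
by elim: r => [|i r IH]; rewrite ?big_nil ?hdot0r // !big_cons hdotDr IH.
Qed.

Lemma hdot_inj x y : (forall z, hdot z x = hdot z y) -> x = y.
Proof.
move=> e; apply/eqP; rewrite -subr_eq0 -normr_eq0 -sqrf_eq0 -hdot_norm.
by rewrite hdotBr e subrr.
Qed.

Lemma rnormE x : `|x| = (rnorm x)%:C.
Proof. by rewrite RRe_real // ger0_real. Qed.
Lemma cabsE a : `|a| = (cabs a)%:C.
Proof. by rewrite RRe_real // ger0_real. Qed.
Lemma rnorm_ge0 x : 0 <= rnorm x.
Proof. by rewrite -ler0c -rnormE. Qed.
Lemma cabs_ge0 a : 0 <= cabs a.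
Proof. by rewrite -ler0c -cabsE. Qed.
Lemma hdot_rnorm x : hdot x x = (rnorm x ^+ 2)%:C.
Proof. by rewrite hdot_norm rnormE rmorphXn. Qed.
Lemma rnormD x y : rnorm (x + y) <= rnorm x + rnorm y.
Proof. by rewrite -lecR rmorphD /= -!rnormE ler_normD. Qed.
Lemma rnormZ a x : rnorm (a *: x) = cabs a * rnorm x.
Proof. by apply: complexI; rewrite rmorphM /= -!rnormE -cabsE normrZ. Qed.
Lemma rnorm_distC x y : rnorm (x - y) = rnorm (y - x).
Proof. by rewrite /rnorm distrC. Qed.
Lemma rnorm_eq0 x : (rnorm x == 0) = (x == 0).
Proof. by rewrite -(normr_eq0 x) rnormE -(inj_eq (@complexI R)). Qed.
Lemma cabsM a b : cabs (a * b) = cabs a * cabs b.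
Proof. by apply: complexI; rewrite rmorphM /= -!cabsE normrM. Qed.
Lemma cabsD a b : cabs (a + b) <= cabs a + cabs b.
Proof. by rewrite -lecR rmorphD /= -!cabsE ler_normD. Qed.
Lemma cabs_real (r : R) : cabs r%:C = `|r|.
Proof. by rewrite /cabs normc_def /= expr0n addr0 sqrtr_sqr. Qed.
Lemma cabs_sqr a : ((cabs a) ^+ 2)%:C = a * a^*%C.
Proof. by rewrite rmorphXn /= -cabsE sqr_normc. Qed.
Lemma cabsJ a : cabs (a^*%C) = cabs a.
Proof. by rewrite /cabs normcJ. Qed.
Lemma ler_Re_cabs a : complex.Re a <= cabs a.
Proof.
by apply: le_trans (ler_norm _) _; rewrite -lecR -cabsE normc_ge_Re.
Qed.

(** Polarization: the value of the form on x + a y is real for a = 1 and for a = i,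
    which makes it hermitian.  This is special to complex scalars. *)
Lemma nonneg_operator_sym (A : H -> H) x y : linear A -> nonneg_operator A ->
  hdot (A x) y = hdot x (A y).
Proof.
move=> lA A0.
have im0 z : complex.Im (hdot (A z) z) = 0 by apply: ger0_Im.
have polar a : complex.Im (a^*%C * hdot (A x) y + a * hdot (A y) x) = 0.
  have := im0 (x + a *: y).
  rewrite (linear_funD lA) (linear_funZ lA) !(hdotDl, hdotDr, hdotZl, hdotZr).
  rewrite !raddfD /= !im0 add0r addrC.
  set u := hdot (A y) y; have -> : u = (complex.Re u)%:C.
    by rewrite RRe_real // (ger0_real (A0 y)).
  case: a (hdot (A x) y) (hdot (A y) x) => a1 a2 [p1 p2] [q1 q2] /=.
  by move=> e; rewrite -[RHS]e; ring.
rewrite [RHS]hdotC; move: (polar 1) (polar 'i).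
case: (hdot (A x) y) (hdot (A y) x) => p1 p2 [q1 q2] /= e1 e2.
by apply/eqP; rewrite eq_complex /=; apply/andP; split; apply/eqP; lra.
Qed.

(** The Cauchy-Schwarz inequality for the possibly degenerate form of A. *)
Lemma nonneg_operator_CS (A : H -> H) x y : linear A -> nonneg_operator A ->
  `|hdot (A x) y| ^+ 2 <= hdot (A x) x * hdot (A y) y.
Proof.
move=> lA A0; set p := hdot (A x) y.
have yx : hdot (A y) x = p^*%C by rewrite nonneg_operator_sym // hdotC.
set P := hdot (A x) x; set Q := hdot (A y) y.
have P0 : 0 <= P := A0 x. have Q0 : 0 <= Q := A0 y.
(* positivity on x - t p y for all real t *)
have key (t : R) : 0 <= P - t%:C * (p * p^*%C) *+ 2 + t%:C ^+ 2 * (p * p^*%C) * Q.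
  have := A0 (x - (t%:C * p) *: y).
  rewrite (linear_funB lA) (linear_funZ lA) !(hdotBl, hdotBr, hdotZl, hdotZr) -/P -/p yx -/Q.
  have -> : ((t%:C * p)^*)%C = t%:C * p^*%C by rewrite -[in RHS](conjc_real t) -rmorphM.
  move=> h; apply: le_trans h _.
  by rewrite le_eqVlt; apply/orP; left; apply/eqP; ring.
rewrite sqr_normc; set n := p * p^*%C in key *.
have n0 : 0 <= n by apply: mulcJ_ge0.
have real (z : R[i]) : 0 <= z -> z = (complex.Re z)%:C.
  by move=> z0; rewrite RRe_real // ger0_real.
have Re0 (z : R[i]) : 0 <= z -> 0 <= complex.Re z.
  by move=> z0; rewrite -ler0c -real.
move: key (Re0 P P0) (Re0 Q Q0) (Re0 n n0).
rewrite (real P P0) (real Q Q0) (real n n0) /=.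
move: (complex.Re P) (complex.Re Q) (complex.Re n) => {}P {}Q {}n key {}P0 {}Q0 {}n0.
rewrite -rmorphM lecR.
have {}key t : 0 <= P - t * n *+ 2 + t ^+ 2 * n * Q.
  by have := key t; rewrite -!rmorphM -rmorphXn -rmorphMn -!rmorphM -rmorphB -rmorphD ler0c.
have [Q_eq|Q_neq] := eqVneq Q 0.
  have [->|n_neq] := eqVneq n 0; first by rewrite mulr_ge0.
  (* a real affine function of t bounded below is constant *)
  have := key ((P + 1) / n); rewrite Q_eq mulr0 addr0 divfK //; lra.
have := key Q^-1; have Qp : 0 < Q by rewrite lt_def Q_neq.
move=> h; have {h} := mulr_ge0 Q0 h; rewrite -[n <= _]subr_ge0 => h; apply: le_trans h _.
rewrite le_eqVlt; apply/orP; left; apply/eqP; field; exact: Q_neq.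
Qed.

Lemma nonneg_id : nonneg_operator (id : H -> H).
Proof. by move=> x; rewrite hdot_norm exprn_ge0. Qed.

Lemma ler_cabs_hdot x y : cabs (hdot x y) <= rnorm x * rnorm y.
Proof.
rewrite -(@ler_pXn2r _ 2) ?nnegrE ?cabs_ge0 ?mulr_ge0 ?rnorm_ge0 //.
have := @nonneg_operator_CS id x y (fun=> fun _ _ => erefl) nonneg_id.
by rewrite !hdot_rnorm cabsE -rmorphXn -rmorphM lecR exprMn.
Qed.

Lemma rnormD_sqr x y :
  rnorm (x + y) ^+ 2 = rnorm x ^+ 2 + rnorm y ^+ 2 + complex.Re (hdot x y) *+ 2.
Proof.
apply: complexI; rewrite -hdot_rnorm !(hdotDl, hdotDr) !hdot_rnorm.
rewrite [hdot y x]hdotC; move: (rnorm x ^+ 2) (rnorm y ^+ 2) => a b.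
case: (hdot x y) => p q; apply/eqP; rewrite eq_complex /=.
by apply/andP; split; apply/eqP; ring.
Qed.

End Hilbert.

(** * Bounded operators, the Riesz theorem and adjoints *)

Section Bounded.
Variables (R : realType) (H : hilbertType R).
Implicit Types (x y z : H) (a : R[i]) (A B : H -> H).

Lemma gtc0_real (eps : R[i]) : 0 < eps -> exists2 e : R, 0 < e & eps = e%:C.
Proof.
move=> e0; have eE : eps = (complex.Re eps)%:C.
  by rewrite RRe_real // gtr0_real.
by exists (complex.Re eps); rewrite // -ltcR -eE.
Qed.

Lemma ex_invS_lt (e : R) : 0 < e ->
  exists N, forall n, (N <= n)%N -> n.+1%:R^-1 < e.
Proof.
by move=> e0; have [N _ HN] := near_infty_natSinv_lt (PosNum e0); exists N.
Qed.

Lemma bounded_operatorP A :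
  bounded_operator A <->
  linear A /\ exists2 K : R, 0 <= K & forall x, rnorm (A x) <= K * rnorm x.
Proof.
split=> -[lA].
  move=> cA; split => //.
  have /linear_boundedP [M [Mreal HM]] : bounded_near (pack_linear lA) (nbhs (0 : H)).
    by apply/linear_bounded_continuous.
  pose K := `|complex.Re M| + 1.
  have K0 : 0 <= K by rewrite addr_ge0.
  exists K => // x; rewrite -lecR rmorphM /= -!rnormE.
  apply: HM; rewrite -(RRe_real Mreal) ltcR /K.
  by rewrite (le_lt_trans (ler_norm _)) // ltrDl.
move=> [K K0 HK]; split => //.
apply/(linear_bounded_continuous (pack_linear lA))/linear_boundedP.
exists K%:C; split; first by rewrite complex_real.
move=> r Kr x; apply: (@le_trans _ _ (K%:C * `|x|)).
  by rewrite !rnormE -rmorphM lecR.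
by rewrite ler_wpM2r // ltW.
Qed.

Lemma bounded_linear A : bounded_operator A -> linear A. Proof. by case. Qed.

(** The representing vector minimizes J x = |x|^2 - 2 Re (phi x).  The parallelogram
    identity makes each minimizing sequence a Cauchy sequence, and the first
    variation of J vanishes at the limit. *)
Lemma riesz (phi : H -> R[i]) (K : R) :
  (forall x y, phi (x + y) = phi x + phi y) ->
  (forall a x, phi (a *: x) = a * phi x) ->
  (forall x, cabs (phi x) <= K * rnorm x) ->
  exists z, forall x, phi x = hdot x z.
Proof.
move=> phiD phiZ phiK.
pose J x := rnorm x ^+ 2 - complex.Re (phi x) *+ 2.
have JD x h (t : R) : J (x + t%:C *: h) = J x + t ^+ 2 * rnorm h ^+ 2
      + (t * complex.Re (hdot h x - phi h)) *+ 2.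
  rewrite /J rnormD_sqr phiD phiZ rnormZ cabs_real hdotC hdotZl exprMn real_normK ?num_real //.
  move: (rnorm x) (rnorm h) => p q.
  by case: (hdot h x) (phi h) (phi x) => u1 u2 [v1 v2] [w1 w2] /=; ring.
have Jlb x : - K ^+ 2 <= J x.
  rewrite /J; have := le_trans (ler_Re_cabs (phi x)) (phiK x).
  have := sqr_ge0 (rnorm x - K); rewrite sqrrB; lra.
pose I := inf (range J).
have hasI : has_inf (range J).
  split; first by exists (J 0); exists 0.
  by exists (- K ^+ 2) => _ [x _ <-].
have IJ x : I <= J x by apply: ge_inf; [exact: hasI.2|exists x].
have /choice [u uI] : forall n, exists x, J x < I + n.+1%:R^-1.
  move=> n.
  have [|_ [x _ <-] xI] := @inf_adherent _ _ n.+1%:R^-1 _ hasI.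
    by rewrite invr_gt0.
  by exists x.
have near_min x y : rnorm (x - y) ^+ 2 <= (J x - I) *+ 2 + (J y - I) *+ 2.
  have := IJ (x + (2^-1)%:C *: (y - x)); rewrite JD /J.
  have := rnormD_sqr x (y - x); rewrite subrKC rnorm_distC.
  have -> : phi (y - x) = phi y - phi x by rewrite phiD -scaleN1r phiZ mulN1r.
  rewrite [hdot (y - x) x]hdotC.
  move: (hdot x (y - x)) (phi x) (phi y) => [a1 a2] [b1 b2] [c1 c2] /=.
  move: (rnorm _ ^+ 2) (rnorm x ^+ 2) (rnorm y ^+ 2) => n p q; lra.
have cvgu : cvg (u @ \oo).
  apply: cauchy_cvg; apply/cauchy_ballP => _ /gtc0_real [e e0 ->].
  have e2 : 0 < e ^+ 2 / 4 by rewrite divr_gt0 // exprn_gt0.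
  have [N HN] := ex_invS_lt e2.
  exists (u @` [set n | (N <= n)%N], u @` [set n | (N <= n)%N]) => /=.
    by split; exists N => // n; exists n.
  move=> [_ _] /= [[n Nn <-] [k Nk <-]].
  rewrite -ball_normE /ball_ /= rnormE ltcR.
  rewrite -(@ltr_pXn2r _ 2) ?nnegrE ?rnorm_ge0 ?ltW //.
  apply: le_lt_trans (near_min _ _) _.
  move: (HN n Nn) (HN k Nk) (uI n) (uI k).
  move: (J (u n)) (J (u k)) n.+1%:R^-1 k.+1%:R^-1 (e ^+ 2) => p q r s w; lra.
pose z := lim (u @ \oo).
have uz (e : R) : 0 < e -> exists N, forall n, (N <= n)%N -> rnorm (z - u n) < e.
  move=> e0; have e0' : 0 < e%:C by rewrite ltcR.
  have /cvgrPdist_lt /(_ _ e0') [N _ HN] : u @ \oo --> z by exact: cvgu.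
  by exists N => n Nn; rewrite -ltcR -rnormE; apply: HN.
(* J (u n + t h) is quadratic in t with minimum near t = - D / |h|^2; the
   denominator s = |h|^2 + 1 also covers h = 0 *)
have first_var n h : complex.Re (hdot h (u n) - phi h) ^+ 2 <= n.+1%:R^-1 * (rnorm h ^+ 2 + 1).
  set D := complex.Re _; set s := rnorm h ^+ 2 + 1.
  have s0 : 0 < s by rewrite ltr_wpDl // sqr_ge0.
  have := lt_le_trans (uI n) (lerD (IJ (u n + (- D / s)%:C *: h)) (lexx _)).
  rewrite JD -/D; have -> : rnorm h ^+ 2 = s - 1 by rewrite addrK.
  have -> : (- D / s) ^+ 2 * (s - 1) = D ^+ 2 / s - D ^+ 2 / s ^+ 2 by field; rewrite gt_eqF.
  have -> : (- D / s) * D = - (D ^+ 2 / s) by field; rewrite gt_eqF.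
  have := divr_ge0 (sqr_ge0 D) (sqr_ge0 s).
  rewrite -[_ <= _ * s]ler_pdivrMr //.
  move: (J (u n)) (D ^+ 2 / s) (D ^+ 2 / s ^+ 2) n.+1%:R^-1 => p q r w; lra.
have Re_eq h : complex.Re (hdot h z) = complex.Re (phi h).
  apply/eqP; rewrite -subr_eq0 -normr_le0; apply/ler_addgt0Pl => e e0.
  set s := rnorm h + 1.
  have s0 : 0 < s by rewrite ltr_wpDl // rnorm_ge0.
  have [N1 HN1] := uz (e / 2 / s) ltac:(by rewrite !divr_gt0).
  have [N2 HN2] := @ex_invS_lt ((e / 2) ^+ 2 / (rnorm h ^+ 2 + 1))
    ltac:(by rewrite divr_gt0 ?exprn_gt0 ?divr_gt0 // ltr_wpDl // sqr_ge0).
  pose n := maxn N1 N2.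
  have h1 := HN1 n (leq_maxl _ _); have h2 := HN2 n (leq_maxr _ _).
  have -> : complex.Re (hdot h z) - complex.Re (phi h) =
     complex.Re (hdot h (z - u n)) + complex.Re (hdot h (u n) - phi h).
    rewrite hdotBr.
    by case: (hdot h z) (hdot h (u n)) (phi h) => ? ? [? ?] [? ?] /=; ring.
  rewrite addr0 (le_trans (ler_normD _ _)) // (splitr e) lerD //.
    rewrite -lecR; apply: le_trans (normc_ge_Re _) _; rewrite cabsE lecR.
    apply: le_trans (ler_cabs_hdot _ _) _; apply: ltW.
    rewrite ltr_pdivlMr // mulrC in h1; apply: le_lt_trans h1.
    by rewrite ler_wpM2r ?rnorm_ge0 // lerDl.
  rewrite -[leRHS]ger0_norm ?(ltW (divr_gt0 e0 _)) // -!sqrtr_sqr ler_wsqrtr //.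
  apply: le_trans (first_var n h) _; rewrite -ler_pdivlMr ?ltW //.
  by rewrite ltr_wpDl // sqr_ge0.
exists z => h; apply/eqP; rewrite eq_complex Re_eq eqxx /=.
(* the imaginary part at h is minus the real part at 'i *: h *)
have := Re_eq ('i *: h); rewrite hdotZl phiZ.
by case: (hdot h z) (phi h) => ? ? [? ?] /= ?; apply/eqP; lra.
Qed.

Lemma adjP A : bounded_operator A -> forall x y, hdot (A x) y = hdot x (adj A y).
Proof.
move=> /bounded_operatorP [lA [K K0 AK]] x y; move: x.
rewrite /adj.
apply: (@xgetPex _ 0 [set z | forall x, hdot (A x) y = hdot x z]).
apply: (@riesz (fun x => hdot (A x) y) (K * rnorm y)).
- by move=> u v; rewrite (linear_funD lA) hdotDl.
- by move=> a u; rewrite (linear_funZ lA) hdotZl.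
- move=> u; apply: le_trans (ler_cabs_hdot _ _) _.
  by rewrite mulrAC ler_wpM2r // rnorm_ge0.
Qed.

Lemma adj_bounded A : bounded_operator A -> bounded_operator (adj A).
Proof.
move=> bA; have aP := adjP bA; apply/bounded_operatorP; split.
  move=> a x y; apply: hdot_inj => z.
  by rewrite -aP !(hdotDr, hdotZr) !aP.
have /bounded_operatorP [lA [K K0 AK]] := bA; exists K => // y.
have [->|n0] := eqVneq (rnorm (adj A y)) 0; first by rewrite mulr_ge0 ?rnorm_ge0.
have np : 0 < rnorm (adj A y) by rewrite lt_def n0 rnorm_ge0.
rewrite -(ler_pM2l np) -expr2 -lecR -hdot_rnorm -aP.
apply: (@le_trans _ _ (cabs (hdot (A (adj A y)) y))%:C).
  by rewrite aP hdot_rnorm cabs_real lecR ler_norm.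
rewrite lecR; apply: le_trans (ler_cabs_hdot _ _) _.
by rewrite mulrCA mulrA ler_wpM2r // rnorm_ge0.
Qed.

Lemma adj_selfadjoint A : bounded_operator A -> nonneg_operator A -> adj A = A.
Proof.
move=> bA A0; apply/funext => y; apply: hdot_inj => x.
by rewrite -adjP // (nonneg_operator_sym _ _ (bounded_linear bA)).
Qed.

Lemma adj_commute A B : bounded_operator A -> bounded_operator B ->
  (forall x, A (B x) = B (A x)) -> forall x, adj A (adj B x) = adj B (adj A x).
Proof. by move=> bA bB AB x; apply: hdot_inj => z; rewrite -!adjP // AB. Qed.

Lemma bounded_id : bounded_operator (id : H -> H).
Proof.
apply/bounded_operatorP; split=> //; exists 1 => // x.
by rewrite mul1r.
Qed.

Lemma bounded_comp A B : bounded_operator A -> bounded_operator B ->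
  bounded_operator (A \o B).
Proof.
move=> /bounded_operatorP [lA [K K0 AK]] /bounded_operatorP [lB [L L0 BL]].
apply/bounded_operatorP; split; first by move=> a x y /=; rewrite lB lA.
exists (K * L); first by rewrite mulr_ge0.
by move=> x; apply: le_trans (AK _) _; rewrite -mulrA ler_wpM2l.
Qed.

Lemma bounded_add A B : bounded_operator A -> bounded_operator B ->
  bounded_operator (fun x => A x + B x).
Proof.
move=> /bounded_operatorP [lA [K K0 AK]] /bounded_operatorP [lB [L L0 BL]].
apply/bounded_operatorP; split.
  by move=> a x y /=; rewrite lB lA scalerDr addrACA.
exists (K + L); first by rewrite addr_ge0.
by move=> x; apply: le_trans (rnormD _ _) _; rewrite mulrDl lerD.
Qed.

Lemma bounded_scale a A : bounded_operator A ->
  bounded_operator (fun x => a *: A x).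
Proof.
move=> /bounded_operatorP [lA [K K0 AK]].
apply/bounded_operatorP; split.
  by move=> b x y /=; rewrite lA scalerDr !scalerA mulrC.
exists (cabs a * K); first by rewrite mulr_ge0 ?cabs_ge0.
by move=> x; rewrite rnormZ -mulrA ler_wpM2l ?cabs_ge0.
Qed.

Lemma bounded_sub A B : bounded_operator A -> bounded_operator B ->
  bounded_operator (fun x => A x - B x).
Proof.
move=> bA /(bounded_scale (-1)) /(bounded_add bA).
by under eq_fun do rewrite scaleN1r.
Qed.

Lemma bounded_sum I (r : seq I) (F : I -> H -> H) :
  (forall i, bounded_operator (F i)) ->
  bounded_operator (fun x => \sum_(i <- r) F i x).
Proof.
move=> bF; elim: r => [|i r IH].
  have -> : (fun x => \sum_(i <- [::]) F i x) = (fun x : H => 0 *: id x).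
    by apply/funext => x; rewrite big_nil scale0r.
  exact: bounded_scale bounded_id.
under eq_fun do rewrite big_cons; exact: bounded_add.
Qed.

Lemma bounded_opprod d (F : 'I_d -> H -> H) :
  (forall i, bounded_operator (F i)) -> bounded_operator (opprod F).
Proof.
rewrite /opprod; elim: d F => [|d IH] F bF.
  by rewrite big_ord0; apply: bounded_id.
by rewrite big_ord_recl; apply: bounded_comp => //; apply: IH.
Qed.

Lemma opnorm_ge A x : bounded_operator A -> rnorm x <= 1 -> rnorm (A x) <= opnorm A.
Proof.
move=> /bounded_operatorP [lA [K K0 AK]] x1.
apply: ub_le_sup; last by exists x.
exists K => _ [y y1 <-]; apply: le_trans (AK y) _.
by rewrite ler_piMr.
Qed.

End Bounded.

(** * Orthonormal families, projections and the Gram-Schmidt process *)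

Section Span.
Variables (R : realType) (H : hilbertType R).
Implicit Types (x y z : H) (V : set H).

Lemma linspan0 V : linspan V 0.
Proof. by exists 0%N, (fun=> 0), (fun=> 0); split; [case|rewrite big_ord0]. Qed.

Lemma linspanD V x y : linspan V x -> linspan V y -> linspan V (x + y).
Proof.
move=> [n [v [c [Vv ->]]]] [n' [v' [c' [Vv' ->]]]].
pose glue T (f : 'I_n -> T) (f' : 'I_n' -> T) (i : 'I_(n + n')) :=
  match fintype.split i with inl j => f j | inr j => f' j end.
exists (n + n')%N, (glue _ v v'), (glue _ c c'); split.
  by move=> i; rewrite /glue; case: fintype.split.
rewrite big_split_ord /glue; congr (_ + _); apply: eq_bigr => i _.
  by rewrite (unsplitK (inl i)).
by rewrite (unsplitK (inr i)).
Qed.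

Lemma linspanZ V (a : R[i]) x : linspan V x -> linspan V (a *: x).
Proof.
move=> [n [v [c [Vv ->]]]]; exists n, v, (fun i => a * c i); split => //.
by rewrite scaler_sumr; apply: eq_bigr => i _; rewrite scalerA.
Qed.

Lemma linspan_gen V x : V x -> linspan V x.
Proof.
by exists 1%N, (fun=> x), (fun=> 1); split; rewrite // big_ord1 scale1r.
Qed.

Lemma linspan_sum V (I : eqType) (r : seq I) (F : I -> H) :
  (forall i, i \in r -> linspan V (F i)) -> linspan V (\sum_(i <- r) F i).
Proof.
elim: r => [|i r IH] VF; first by rewrite big_nil; exact: linspan0.
rewrite big_cons; apply: linspanD; first by apply: VF; rewrite mem_head.
by apply: IH => j jr; apply: VF; rewrite inE jr orbT.
Qed.

Lemma linspanB V x y : linspan V x -> linspan V y -> linspan V (x - y).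
Proof. by rewrite -scaleN1r => Vx /(linspanZ (-1)); apply: linspanD. Qed.

Lemma linspan_sub V (P : set H) : P 0 -> (forall x y, P x -> P y -> P (x + y)) ->
  (forall (a : R[i]) x, P x -> P (a *: x)) -> V `<=` P -> linspan V `<=` P.
Proof.
move=> P0 PD PZ VP x [n [v [c [Vv ->]]]].
by elim/big_ind: _ => // i _; apply/PZ/VP.
Qed.

Lemma linspan_mono V V' : V `<=` linspan V' -> linspan V `<=` linspan V'.
Proof.
apply: linspan_sub; [exact: linspan0|exact: linspanD|].
by move=> a x; exact: linspanZ.
Qed.

End Span.

Section Orthonormal.
Variables (R : realType) (H : hilbertType R).
Implicit Types (x y z : H) (s t l : seq H).

(** Orthonormality by recursion on the list, the form that suits the recursive
    Gram-Schmidt process. *)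
Fixpoint orthonormal s : Prop :=
  if s is e :: s' then
    [/\ hdot e e = 1, forall f, f \in s' -> hdot e f = 0 & orthonormal s']
  else True.

Definition proj s x : H := \sum_(e <- s) hdot x e *: e.

Lemma hdot_sum_orthogonal s (c : H -> R[i]) y :
  (forall e, e \in s -> hdot e y = 0) -> hdot (\sum_(e <- s) c e *: e) y = 0.
Proof.
move=> sy; rewrite hdot_suml big1_seq // => e /andP[_ es].
by rewrite hdotZl sy // mulr0.
Qed.

Lemma hdot_proj_mem s x e : orthonormal s -> e \in s -> hdot (proj s x) e = hdot x e.
Proof.
rewrite /proj; elim: s => // f s IH [f1 fs os]; rewrite inE big_cons hdotDl hdotZl.
case/orP=> [/eqP ->|es]; last by rewrite fs // mulr0 add0r IH.
rewrite f1 mulr1 hdot_sum_orthogonal ?addr0 // => g gs.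
by rewrite hdotC fs // conjc0.
Qed.

Lemma proj_orthogonal s x y : orthonormal s -> hdot (x - proj s x) (proj s y) = 0.
Proof.
move=> os; rewrite hdotC hdot_sum_orthogonal ?conjc0 // => e es.
by rewrite hdotC hdotBl hdot_proj_mem // subrr conjc0.
Qed.

Lemma proj_linear s : linear (proj s).
Proof.
move=> a x y; rewrite /proj scaler_sumr -big_split; apply: eq_bigr => e _ /=.
by rewrite hdotDl hdotZl scalerDl scalerA.
Qed.

Lemma proj_id s x : orthonormal s -> proj s (proj s x) = proj s x.
Proof.
move=> os; rewrite {1}/proj; apply: eq_big_seq => e es.
by rewrite hdot_proj_mem.
Qed.

Lemma proj_selfadjoint s x y : hdot (proj s x) y = hdot x (proj s y).
Proof.
rewrite /proj hdot_suml hdot_sumr; apply: eq_bigr => e _.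
by rewrite hdotZl hdotZr [hdot y e]hdotC conjcK mulrC.
Qed.

Lemma proj_mem s e : orthonormal s -> e \in s -> proj s e = e.
Proof.
rewrite /proj; elim: s => // f s IH [f1 fs os]; rewrite inE big_cons.
case/orP=> [/eqP ->|es].
  rewrite f1 scale1r big1_seq ?addr0 // => g /andP[_ gs].
  by rewrite fs // scale0r.
by rewrite IH // hdotC fs // conjc0 scale0r add0r.
Qed.

Lemma rnorm_proj_sqr s x : orthonormal s ->
  rnorm x ^+ 2 = rnorm (proj s x) ^+ 2 + rnorm (x - proj s x) ^+ 2.
Proof.
move=> os; rewrite -[in LHS](subrKC (proj s x) x) [LHS]rnormD_sqr.
by rewrite [hdot (proj s x) _]hdotC proj_orthogonal // conjc0 /= mul0rn addr0.
Qed.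

Lemma rnorm_proj_le s x : orthonormal s -> rnorm (proj s x) <= rnorm x.
Proof.
move=> os; rewrite -(@ler_pXn2r _ 2) ?nnegrE ?rnorm_ge0 //.
by rewrite [leRHS](rnorm_proj_sqr _ os) lerDl sqr_ge0.
Qed.

Lemma proj_bounded s : orthonormal s -> bounded_operator (proj s).
Proof.
move=> os; apply/bounded_operatorP; split; first exact: proj_linear.
by exists 1 => // x; rewrite mul1r rnorm_proj_le.
Qed.

Lemma proj_best s x y : orthonormal s -> proj s y = y ->
  rnorm (x - proj s x) <= rnorm (x - y).
Proof.
move=> os yE; rewrite -(@ler_pXn2r _ 2) ?nnegrE ?rnorm_ge0 //.
rewrite [leRHS](rnorm_proj_sqr _ os) (linear_funB (@proj_linear s)) yE.
by rewrite opprB addrA addrNK lerDr sqr_ge0.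
Qed.

Lemma parseval s x : orthonormal s ->
  \sum_(e <- s) cabs (hdot x e) ^+ 2 = rnorm (proj s x) ^+ 2.
Proof.
move=> os; apply: complexI; rewrite -hdot_rnorm proj_selfadjoint proj_id //.
rewrite /proj hdot_sumr rmorph_sum /=; apply: eq_bigr => e _.
by rewrite hdotZr cabs_sqr mulrC.
Qed.

Lemma bessel s x : orthonormal s -> \sum_(e <- s) cabs (hdot x e) ^+ 2 <= rnorm x ^+ 2.
Proof.
move=> os; rewrite parseval //.
by rewrite ler_pXn2r ?nnegrE ?rnorm_ge0 // rnorm_proj_le.
Qed.

Lemma orthonormal_rnorm s e : orthonormal s -> e \in s -> rnorm e = 1.
Proof.
elim: s => // f s IH [f1 _ os]; rewrite inE => /orP[/eqP ->|/IH -> //].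
apply/eqP; rewrite -sqrp_eq1 ?rnorm_ge0 //; apply/eqP/complexI.
by rewrite -hdot_rnorm f1.
Qed.

Lemma orthonormal_neq s e f : orthonormal s -> e \in s -> f \in s -> e <> f ->
  hdot e f = 0.
Proof.
elim: s => // g s IH [_ gs os]; rewrite !inE.
case/orP=> [/eqP ->|es] /orP[/eqP ->|fs] //.
- by move=> _; apply: gs.
- by move=> _; rewrite hdotC gs // conjc0.
- exact: IH.
Qed.

(** Vectors are processed from the tail of the list and those that depend linearly
    on the later ones are dropped.  Hence the result for a suffix is a suffix of the
    result. *)
Fixpoint gram_schmidt l : seq H :=
  if l is x :: l' then
    let s := gram_schmidt l' in
    let r := x - proj s x in
    if r == 0 then s else (rnorm r)^-1%:C *: r :: s
  else [::].

Lemma gram_schmidt_orthonormal l : orthonormal (gram_schmidt l).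
Proof.
elim: l => //= x l os; case: eqVneq => //= r0.
set r := x - _ in r0 *; split => //.
  rewrite hdotZl hdotZr conjc_real hdot_rnorm -!rmorphM /= expr2.
  by rewrite mulKf ?mulVf ?rnorm_eq0.
move=> f fs; rewrite hdotZl -(proj_mem os fs).
by rewrite proj_orthogonal // mulr0.
Qed.

Lemma gram_schmidt_span l x : linspan [set` l] x -> proj (gram_schmidt l) x = x.
Proof.
have lin := proj_linear (gram_schmidt l).
move: x; apply: linspan_sub => [|x y /= ex ey|a x /= ex|].
- exact: linear_fun0 lin.
- by rewrite (linear_funD lin) ex ey.
- by rewrite (linear_funZ lin) ex.
elim: l {lin} => // x l IH y /=; rewrite inE.
have os := gram_schmidt_orthonormal l.
have os' := gram_schmidt_orthonormal (x :: l); move: os' => /=.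
case: eqVneq => [/eqP|r0 os'].
  by rewrite subr_eq0 => /eqP xE _ /predU1P[->|/IH //]; exact: esym xE.
set r := x - _ in r0 os' *; set e := _ *: r in os' *.
have lin := proj_linear (e :: gram_schmidt l).
have keep z : proj (gram_schmidt l) z = z -> proj (e :: gram_schmidt l) z = z.
  move=> zE; rewrite /proj big_cons -[X in _ + X]/(proj _ z) zE.
  rewrite hdotC hdotZl -zE proj_orthogonal // mulr0 conjc0 scale0r add0r //.
move=> /predU1P[->|/IH /keep //].
have -> : x = (rnorm r)%:C *: e + proj (gram_schmidt l) x.
  by rewrite scalerA -rmorphM mulfV ?rnorm_eq0 // scale1r subrK.
rewrite (linear_funD lin) (linear_funZ lin) (keep _ (proj_id x os)).
by rewrite (proj_mem os') ?mem_head.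
Qed.

Lemma gram_schmidt_sub l e : e \in gram_schmidt l -> linspan [set` l] e.
Proof.
elim: l e => // x l IH e /=.
have sub : linspan [set` l] `<=` linspan [set` x :: l].
  apply: linspan_mono => y /= yl; apply: linspan_gen => /=.
  by rewrite inE yl orbT.
case: ifP => _; first by move=> /IH /sub.
rewrite inE => /predU1P[->|/IH /sub //].
apply/linspanZ/linspanB; first by apply: linspan_gen; rewrite /= mem_head.
by apply: linspan_sum => f fs; apply/linspanZ/sub/IH.
Qed.

Lemma proj_gram_schmidt_sub l x : linspan [set` l] (proj (gram_schmidt l) x).
Proof. by apply: linspan_sum => f fs; apply/linspanZ/gram_schmidt_sub. Qed.

Lemma gram_schmidt_cat l l' :
  exists2 t, gram_schmidt (l ++ l') = t ++ gram_schmidt l' & (size t <= size l)%N.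
Proof.
elim: l => [|x l [t /= -> tl]]; first by exists [::].
case: ifP => _; first by exists t => //; exact: leqW.
by eexists (_ :: t).
Qed.

Lemma orthproj_gram_schmidt l x :
  orthproj (linspan [set` l]) x = proj (gram_schmidt l) x.
Proof.
have os := gram_schmidt_orthonormal l.
apply: xget_unique.
  split; first exact: proj_gram_schmidt_sub.
  by move=> w /gram_schmidt_span <-; rewrite proj_orthogonal.
move=> y [yl xy]; have yP := gram_schmidt_span yl.
rewrite -yP; have lin := proj_linear (gram_schmidt l).
apply/esym/eqP; rewrite -subr_eq0 -(linear_funB lin) -rnorm_eq0 -sqrf_eq0.
apply/eqP/complexI; rewrite -hdot_rnorm proj_selfadjoint proj_id // xy //.
exact: proj_gram_schmidt_sub.
Qed.

(** One step subtracts from A the rank one operator along A f / sqrt <A f, f>.  The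
    remainder stays nonnegative by Cauchy-Schwarz, kills f and still kills whatever
    A killed.  On the span of s the form of A thus becomes a finite sum of squares,
    without a square root of A or a diagonalization. *)
Lemma cholesky (A : H -> H) s : linear A -> nonneg_operator A ->
  exists hs (A' : H -> H), [/\ linear A', nonneg_operator A',
    forall f, f \in s -> A' f = 0 &
    forall x, A x = A' x + \sum_(h <- hs) hdot x h *: h].
Proof.
move=> lA A0; elim: s => [|f s [hs [A' [lA' A'0 A's AE]]]].
  by exists [::], A; split => // x; rewrite big_nil addr0.
pose q := complex.Re (hdot (A' f) f).
have qE : hdot (A' f) f = q%:C by rewrite RRe_real // ger0_real.
have q0 : 0 <= q by rewrite -ler0c -qE.
pose h := (Num.sqrt q)^-1%:C *: A' f.
have hE x : hdot x h *: h = (q^-1%:C * hdot (A' x) f) *: A' f.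
  rewrite /h hdotZr conjc_real scalerA mulrAC -rmorphM -invfM -expr2 sqr_sqrtr //.
  by rewrite -(nonneg_operator_sym _ _ lA').
(* in the degenerate case h is zero and A' already kills f *)
have A'f x : q = 0 -> hdot (A' x) f = 0.
  move=> qq; apply/eqP; rewrite -normr_eq0 -sqrf_eq0 eq_le exprn_ge0 // andbT.
  by apply: le_trans (nonneg_operator_CS _ _ lA' A'0) _; rewrite qE qq mulr0.
exists (h :: hs), (fun x => A' x - hdot x h *: h); split.
- move=> a x y /=; rewrite lA' hdotDl hdotZl scalerDl -scalerA scalerBr.
  by rewrite opprD addrACA.
- move=> x; rewrite hE hdotBl hdotZl.
  have -> : hdot (A' f) x = (hdot (A' x) f)^*%C.
    by rewrite (nonneg_operator_sym _ _ lA' A'0) -hdotC.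
  rewrite -mulrA -sqr_normc subr_ge0.
  have [qq|qn] := eqVneq q 0; first by rewrite qq invr0 mul0r.
  rewrite mulrC rmorphV /= ?unitfE // ler_pdivrMr; last first.
    by rewrite ltcR lt_def qn q0.
  by rewrite -qE; apply: nonneg_operator_CS.
- move=> g; rewrite inE hE => /predU1P[->|gs]; last first.
    by rewrite A's // hdot0l mulr0 scale0r subr0.
  rewrite qE -rmorphM; have [qq|qn] := eqVneq q 0; last first.
    by rewrite mulVf // scale1r subrr.
  rewrite qq mulr0 scale0r subr0; apply: hdot_inj => x.
  by rewrite -(nonneg_operator_sym _ _ lA' A'0) A'f // hdot0r.
- by move=> x; rewrite big_cons addrA subrK.
Qed.

(** On the span of s the form of A is a sum of squares |<x, h>|^2 by the Cholesky
    decomposition.  For each h, Bessel's inequality for t and Parseval's identity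
    for s compare the two sides. *)
Lemma compression_trace_le (A : H -> H) s t : linear A -> nonneg_operator A ->
  orthonormal s -> orthonormal t ->
  \sum_(e <- t) complex.Re (hdot (A (proj s e)) (proj s e))
    <= \sum_(f <- s) complex.Re (hdot (A f) f).
Proof.
move=> lA A0 os ot; have [hs [A' [lA' A'0 A's AE]]] := cholesky s lA A0.
have quad x : proj s x = x ->
    complex.Re (hdot (A x) x) = \sum_(h <- hs) cabs (hdot x h) ^+ 2.
  move=> xE; rewrite AE -[in A' x]xE /proj (linear_fun_sum lA') big1_seq ?add0r; last first.
    by move=> e /andP[_ es]; rewrite (linear_funZ lA') A's // scaler0.
  apply: complexI; rewrite hdot_suml rmorph_sum /=.
  rewrite (eq_bigr (fun h => ((cabs (hdot x h)) ^+ 2)%:C)); last first.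
    by move=> h _; rewrite hdotZl cabs_sqr [hdot h x]hdotC.
  by rewrite -rmorph_sum.
under eq_bigr => e _ do rewrite quad ?proj_id //.
rewrite [leRHS](eq_big_seq (fun f => \sum_(h <- hs) cabs (hdot f h) ^+ 2)); last first.
  by move=> f fs; rewrite quad // proj_mem.
rewrite exchange_big [leRHS]exchange_big; apply: ler_sum => h _ /=.
have -> : \sum_(f <- s) cabs (hdot f h) ^+ 2 = rnorm (proj s h) ^+ 2.
  by rewrite -parseval //; apply: eq_bigr => f _; rewrite hdotC cabsJ.
apply: le_trans (bessel (proj s h) ot); rewrite le_eqVlt; apply/orP; left.
by apply/eqP/eq_bigr => e _; rewrite proj_selfadjoint hdotC cabsJ.
Qed.

End Orthonormal.

(** * The ring of linear operators and the determinant operator *)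

Section LinearOperators.
Variables (K : pzRingType) (V : lmodType K).

(** Linear endomorphisms with composition as product, so that identities of
    noncommutative rings apply to operators. *)
Record lin_op := LinOp { op_fun :> V -> V; op_linear : linear op_fun }.

Lemma lin_op_ext (f g : lin_op) : (forall x, f x = g x) -> f = g.
Proof.
case: f g => f lf [g lg] /= /funext fg; rewrite fg in lf *.
by rewrite (Prop_irrelevance lf lg).
Qed.

HB.instance Definition _ := gen_eqMixin lin_op.
HB.instance Definition _ := gen_choiceMixin lin_op.

Fact zero_op_linear : linear (fun _ : V => 0 : V).
Proof. by move=> a x y; rewrite scaler0 addr0. Qed.
Fact opp_op_linear (f : lin_op) : linear (fun x => - f x).
Proof. by move=> a x y; rewrite op_linear opprD scalerN. Qed.
Fact add_op_linear (f g : lin_op) : linear (fun x => f x + g x).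
Proof. by move=> a x y; rewrite !op_linear scalerDr addrACA. Qed.
Fact id_op_linear : linear (id : V -> V). Proof. by []. Qed.
Fact comp_op_linear (f g : lin_op) : linear (f \o g).
Proof. by move=> a x y; rewrite /= !op_linear. Qed.

Let add_op f g := LinOp (add_op_linear f g).
Let mul_op f g := LinOp (comp_op_linear f g).

Fact add_opA : associative add_op.
Proof. by move=> f g h; apply: lin_op_ext => x; rewrite /= addrA. Qed.
Fact add_opC : commutative add_op.
Proof. by move=> f g; apply: lin_op_ext => x; rewrite /= addrC. Qed.
Fact add_0op : left_id (LinOp zero_op_linear) add_op.
Proof. by move=> f; apply: lin_op_ext => x; rewrite /= add0r. Qed.
Fact add_Nop :
  left_inverse (LinOp zero_op_linear) (fun f => LinOp (opp_op_linear f)) add_op.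
Proof. by move=> f; apply: lin_op_ext => x; rewrite /= addNr. Qed.
HB.instance Definition _ :=
  GRing.isZmodule.Build lin_op add_opA add_opC add_0op add_Nop.

Fact mul_opA : associative mul_op.
Proof. by move=> f g h; apply: lin_op_ext. Qed.
Fact mul_1op : left_id (LinOp id_op_linear) mul_op.
Proof. by move=> f; apply: lin_op_ext. Qed.
Fact mul_op1 : right_id (LinOp id_op_linear) mul_op.
Proof. by move=> f; apply: lin_op_ext. Qed.
Fact mul_opDl : left_distributive mul_op +%R.
Proof. by move=> f g h; apply: lin_op_ext. Qed.
Fact mul_opDr : right_distributive mul_op +%R.
Proof.
by move=> f g h; apply: lin_op_ext => x; rewrite /= (linear_funD (op_linear f)).
Qed.
HB.instance Definition _ :=
  GRing.Zmodule_isPzRing.Build lin_op mul_opA mul_1op mul_op1 mul_opDl mul_opDr.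

Lemma sum_opE I (r : seq I) (F : I -> lin_op) x :
  (\sum_(i <- r) F i) x = \sum_(i <- r) F i x.
Proof. by elim: r => [|i r IH]; rewrite ?big_nil // !big_cons /= -IH. Qed.

Lemma sign_opE (b : bool) (f : lin_op) x : ((-1) ^+ b * f) x = (-1) ^+ b *: f x.
Proof. by case: b; rewrite ?expr1 ?mulN1r ?scaleN1r // mul1r scale1r. Qed.

End LinearOperators.

Section DeterminantOperator.
Variables (R : realType) (H : hilbertType R).

Lemma prod_opE d (F : 'I_d -> lin_op H) :
  \prod_i F i = opprod (fun i => F i : H -> H) :> (H -> H).
Proof.
rewrite /opprod; elim: d F => [|d IH] F; first by rewrite !big_ord0.
by rewrite !big_ord_recl -IH.
Qed.

Lemma dEt_alternating_word n (T : 'I_n.+1 -> H -> H) x :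
  (forall i, bounded_operator (T i)) -> commuting T ->
  dEt (commutator_block T) x =
  \sum_(t : 'S_n.+1) (-1) ^+ t *:
    (alternating_word T t (T (t ord_max) x) - T (t ord_max) (alternating_word T t x)).
Proof.
move=> bT cT.
pose X i := LinOp (bounded_linear (adj_bounded (bT i))).
pose Y i := LinOp (bounded_linear (bT i)).
have XC i j : X i * X j = X j * X i.
  by apply: lin_op_ext => z; apply: adj_commute => //; apply: cT.
have YC i j : Y i * Y j = Y j * Y i by apply: lin_op_ext => z; apply: cT.
have WE t z : alt_word X Y t z = alternating_word T t z.
  rewrite sum_opE; apply: eq_bigr => u _; rewrite sign_opE prod_opE.
  congr (_ *: opprod _ z); apply/funext => i.
  by rewrite /=; case: ifP.
have := congr1 (fun f : lin_op H => f x) (sum_alt_commutators XC YC).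
rewrite /= !sum_opE => e; rewrite /dEt; etransitivity; last first.
  by apply: etrans e _; apply: eq_bigr => t _; rewrite sign_opE /= !WE.
apply: eq_bigr => s _; rewrite sum_opE; apply: eq_bigr => t _.
by rewrite sign_opE prod_opE.
Qed.

Lemma alternating_word_bounded d (T : 'I_d -> H -> H) t :
  (forall i, bounded_operator (T i)) -> bounded_operator (alternating_word T t).
Proof.
move=> bT; apply: bounded_sum => u; apply/bounded_scale/bounded_opprod => i.
apply: bounded_comp; first exact: adj_bounded.
by case: ifP => _ //; apply: bounded_id.
Qed.

Lemma dEt_bounded d (B : 'I_d -> 'I_d -> H -> H) :
  (forall i j, bounded_operator (B i j)) -> bounded_operator (dEt B).
Proof.
by move=> bB; do 2 apply: bounded_sum => ?; apply/bounded_scale/bounded_opprod.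
Qed.

Lemma commutator_block_bounded d (T : 'I_d -> H -> H) i j :
  (forall i, bounded_operator (T i)) -> bounded_operator (commutator_block T i j).
Proof.
move=> bT; have bA := adj_bounded (bT j).
by apply: bounded_sub; apply: bounded_comp.
Qed.

(** The trace of a commutator vanishes in finite dimension, so the compression of
    W T - T W to the span of r only retains the defect of multiplicativity, the
    trace of P W (1 - P) T P.  The vectors of s do not contribute to it because T
    maps them into the span of r. *)
Lemma trace_compressed_commutator (W T : H -> H) (t s : seq H) (beta : R) :
  let r := t ++ s in
  bounded_operator W -> bounded_operator T -> orthonormal r ->
  (forall x, proj r (T (x - proj r x)) = 0) ->
  (forall f, f \in s -> proj r (T f) = T f) ->
  (forall x, rnorm x <= 1 ->
     rnorm (proj r (W (T (proj r x) - proj r (T (proj r x))))) <= beta) ->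
  cabs (\sum_(f <- r) hdot (W (T f) - T (W f)) f) <= (size t)%:R * beta.
Proof.
move=> r bW bT or inv_perp shift Wbeta.
have lW := bounded_linear bW; have lT := bounded_linear bT.
(* expansion of W T and of T W through the basis r; the double sums agree *)
have split_WT f : hdot (W (T f)) f = \sum_(g <- r) hdot (T f) g * hdot (W g) f
    + hdot (W (T f - proj r (T f))) f.
  rewrite (linear_funB lW) hdotBl addrC -[LHS](subrK (hdot (W (proj r (T f))) f)).
  congr (_ + _); rewrite (linear_fun_sum lW) hdot_suml.
  by apply: eq_bigr => g _; rewrite (linear_funZ lW) hdotZl.
have split_TW f : f \in r ->
    hdot (T (W f)) f = \sum_(g <- r) hdot (W f) g * hdot (T g) f.
  move=> fr; rewrite -{1}(subrK (proj r (W f)) (W f)) (linear_funD lT) hdotDl.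
  rewrite -[X in hdot (T (_ - _)) X](proj_mem or fr) -proj_selfadjoint.
  rewrite inv_perp hdot0l add0r (linear_fun_sum lT) hdot_suml.
  by apply: eq_bigr => g _; rewrite (linear_funZ lT) hdotZl.
have -> : \sum_(f <- r) hdot (W (T f) - T (W f)) f
        = \sum_(f <- r) hdot (W (T f - proj r (T f))) f.
  rewrite (eq_big_seq (fun f => (\sum_(g <- r) hdot (T f) g * hdot (W g) f
    - \sum_(g <- r) hdot (W f) g * hdot (T g) f) + hdot (W (T f - proj r (T f))) f)).
    rewrite big_split sumrB /= [X in _ - X]exchange_big /=.
    rewrite [X in _ - X](_ : _ = \sum_(f <- r) \sum_(g <- r) hdot (T f) g * hdot (W g) f).
      by rewrite subrr add0r.
    by apply: eq_bigr => f _; apply: eq_bigr => g _; rewrite mulrC.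
  by move=> f fr; rewrite hdotBl split_WT split_TW // addrAC.
rewrite big_cat /= [X in _ + X]big1_seq ?addr0; last first.
  by move=> f /andP[_ fs]; rewrite shift // subrr (linear_fun0 lW) hdot0l.
have : {subset t <= r} by move=> f ft; rewrite mem_cat ft.
elim: (t) => [|f u IH] sub.
  by rewrite big_nil /= mul0r /cabs normr0.
have fr : f \in r by apply: sub; rewrite mem_head.
have -> : (size (f :: u))%:R * beta = beta + (size u)%:R * beta.
  by rewrite /= -natr1 mulrDl mul1r addrC.
rewrite big_cons.
apply: le_trans (cabsD _ _) _; apply: lerD; last first.
  by apply: IH => g gu; apply: sub; rewrite inE gu orbT.
have f1 := orthonormal_rnorm or fr.
rewrite -[X in hdot _ X](proj_mem or fr) -proj_selfadjoint.
apply: le_trans (ler_cabs_hdot _ _) _; rewrite f1 mulr1.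
by have := Wbeta f; rewrite (proj_mem or fr) f1; apply.
Qed.

End DeterminantOperator.

(** * The degree filtration *)

Section Monomials.
Variables (R : realType) (H : hilbertType R).

Lemma opprod_absorb d (F : 'I_d -> H -> H) (f : H -> H) (j : 'I_d) x :
  (forall i y, f (F i y) = F i (f y)) ->
  f (opprod F x) = opprod (fun i => if i == j then f \o F i else F i) x.
Proof.
rewrite /opprod; elim: d F j x => [|d IH] F j x fF; first by case: j.
rewrite !big_ord_recl /=; case: (unliftP ord0 j) => [k|] -> //=.
  by rewrite fF (IH _ k x (fun i y => fF (lift ord0 i) y)).
Qed.

Lemma iter_commute (f g : H -> H) n x :
  (forall y, f (g y) = g (f y)) -> f (iter n g x) = iter n g (f x).
Proof. by move=> fg; elim: n => //= n <-. Qed.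

Lemma monomial_shift d (T : 'I_d -> H -> H) (a : 'I_d -> nat) j x :
  commuting T -> T j (monomial T a x) = monomial T (fun i => (i == j) + a i)%N x.
Proof.
move=> cT; rewrite /monomial (opprod_absorb j); last first.
  by move=> i y; apply: iter_commute => z; apply: cT.
congr (opprod _ x); apply/funext => i; case: eqP => [->|] //=.
Qed.

Variables (d m : nat) (T : 'I_d -> H -> H) (xi : 'I_m -> H).

Definition multidegrees (N : nat) : seq ('I_d -> nat) :=
  [seq (fun i => nat_of_ord (tnth t i)) |
     t <- enum [set t : d.-tuple 'I_N.+1 | (\sum_(i <- t) i == N)%N]%SET].

Definition layer (N : nat) : seq H :=
  [seq monomial T a (xi k) | a <- multidegrees N, k <- enum 'I_m].

(** The monomials of degree less than N applied to the cyclic vectors.  Those of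
    highest degree come first, so that the Gram-Schmidt bases are nested. *)
Fixpoint layers (N : nat) : seq H :=
  if N is N'.+1 then layer N' ++ layers N' else [::].

Lemma mem_layer N x : x \in layer N <->
  exists a k, (\sum_i a i = N)%N /\ x = monomial T a (xi k).
Proof.
split=> [/allpairsP[[a k] /= [/mapP[t]]]|[a [k [aN ->]]]].
  rewrite mem_enum inE => /eqP tN -> _ ->; exists (fun i => nat_of_ord (tnth t i)), k.
  by split => //; rewrite -[RHS]tN big_tuple.
have aN' i : (a i <= N)%N by rewrite -aN (bigD1 i) //= leq_addr.
pose t : d.-tuple 'I_N.+1 := [tuple inord (a i) | i < d].
have ta i : tnth t i = a i :> nat by rewrite tnth_mktuple inordK // ltnS.
apply/allpairsP; exists (a, k); split => //=; last by rewrite mem_enum.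
apply/mapP; exists t; last by apply/funext => i; rewrite ta.
rewrite mem_enum inE big_tuple -[X in _ == X]aN; apply/eqP.
by apply: eq_bigr => i _; rewrite ta.
Qed.

Lemma mem_layers N x : x \in layers N <->
  exists a k, (\sum_i a i < N)%N /\ x = monomial T a (xi k).
Proof.
elim: N x => [|N IH] x /=; first by split=> // -[a [k []]].
rewrite mem_cat; split.
  case/orP=> [/mem_layer|/IH] [a [k [aN ->]]]; exists a, k; split => //.
    by rewrite aN.
  exact: ltnW.
case=> a [k [aN ->]]; move: aN; rewrite ltnS leq_eqVlt => /predU1P[aN|aN].
  by apply/orP; left; apply/mem_layer; exists a, k.
by apply/orP; right; apply/IH; exists a, k.
Qed.

Lemma filtrationE N : filtration T xi N = linspan [set` layers N.+1].
Proof.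
congr linspan; apply/seteqP; split => x /=.
  by move=> [a aN [k _ <-]]; apply/(mem_layers N.+1); exists a, k.
by move=> /(mem_layers N.+1)[a [k [aN ->]]]; exists a => //; exists k.
Qed.

Lemma layers_shift N j x : commuting T -> x \in layers N -> T j x \in layers N.+1.
Proof.
move=> cT /mem_layers[a [k [aN ->]]]; apply/mem_layers.
exists (fun i => (i == j) + a i)%N, k; split; last exact: monomial_shift.
rewrite big_split /= ltnS (bigD1 j) //= eqxx big1 ?addn0 // => i /negPf -> //.
Qed.

Definition layer_proj N : H -> H := proj (gram_schmidt (layers N)).

Lemma orthproj_filtration N : orthproj (filtration T xi N) = layer_proj N.+1.
Proof. by rewrite filtrationE; apply/funext => x; apply: orthproj_gram_schmidt. Qed.

(** The monomials in a given linear combination have bounded degree. *)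
Lemma layer_proj_linspan x :
  linspan [set monomial T a (xi k) | a in setT & k in setT] x ->
  exists N0, forall N, (N0 <= N)%N -> layer_proj N x = x.
Proof.
move: x; apply: linspan_sub => [|x y [N1 H1] [N2 H2]|a x [N0 HN]|].
- exists 0%N => N _; exact: (linear_fun0 (proj_linear _)).
- exists (maxn N1 N2) => N; rewrite geq_max => /andP[h1 h2].
  by rewrite /layer_proj (linear_funD (proj_linear _)) [X in X + _]H1 // [X in _ + X]H2.
- exists N0 => N h; rewrite /layer_proj (linear_funZ (proj_linear _)).
  by rewrite [X in _ *: X]HN.
move=> x [a _ [k _ <-]]; exists (\sum_i a i).+1 => N aN.
apply: gram_schmidt_span; apply: linspan_gen => /=.
by apply/mem_layers; exists a, k.
Qed.

Lemma layer_proj_approx (x : H) (e : R) : cyclic_family T xi -> 0 < e ->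
  exists N0, forall N, (N0 <= N)%N -> rnorm (x - layer_proj N x) < e.
Proof.
move=> [_ dense_xi] e0.
have : closure (linspan [set monomial T a (xi k) | a in setT & k in setT]) x.
  by rewrite dense_xi.
have e0' : 0 < e%:C by rewrite ltcR.
move=> /(_ (ball x e%:C)) /(_ (nbhsx_ballx _ _ e0')) [y [/layer_proj_linspan [N0 HN] xy]].
exists N0 => N /HN yE; apply: le_lt_trans (proj_best _ _ yE) _.
  exact: gram_schmidt_orthonormal.
by rewrite -ltcR -rnormE; move: xy; rewrite -ball_normE.
Qed.

Lemma layer_proj_approx_seq (s : seq H) (e : R) : cyclic_family T xi -> 0 < e ->
  exists N, forall x, x \in s -> rnorm (x - layer_proj N x) < e.
Proof.
move=> cxi e0; suff [N0 HN] : exists N0, forall N, (N0 <= N)%N ->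
    forall x, x \in s -> rnorm (x - layer_proj N x) < e.
  by exists N0; apply: HN.
elim: s => [|x s [N1 H1]]; first by exists 0%N.
have [N2 H2] := layer_proj_approx x cxi e0.
exists (maxn N1 N2) => N; rewrite geq_max => /andP[h1 h2] y.
by rewrite inE => /predU1P[->|ys]; [apply: H2|apply: H1].
Qed.

Definition layer_basis : set H := [set e | exists N, e \in gram_schmidt (layers N)].

Lemma gram_schmidt_layers_le N N' e : (N <= N')%N ->
  e \in gram_schmidt (layers N) -> e \in gram_schmidt (layers N').
Proof.
elim: N' => [|N' IH]; first by rewrite leqn0 => /eqP ->.
rewrite leq_eqVlt => /predU1P[-> //|/IH h /h eN'] /=.
have [t -> _] := gram_schmidt_cat (layer N') (layers N').
by rewrite mem_cat eN' orbT.
Qed.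

Lemma layer_basis_orthonormal : cyclic_family T xi -> orthonormal_basis layer_basis.
Proof.
have os N := gram_schmidt_orthonormal (layers N).
move=> [_ dense_xi]; split.
- move=> e [N eN]; rewrite hdot_rnorm (orthonormal_rnorm (os N) eN).
  by rewrite expr1n.
- move=> e f [N eN] [N' fN'] ef.
  apply: (orthonormal_neq (os (maxn N N'))) => //.
    by apply: gram_schmidt_layers_le eN; apply: leq_maxl.
  by apply: gram_schmidt_layers_le fN'; apply: leq_maxr.
apply/seteqP; split => // x _.
have : closure (linspan [set monomial T a (xi k) | a in setT & k in setT]) x.
  by rewrite dense_xi.
apply: closureS => y /layer_proj_linspan [N /(_ _ (leqnn N)) <-].
by apply: linspan_sum => e eN; apply/linspanZ/linspan_gen; exists N.
Qed.

End Monomials.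

(** Monomials of degree N in n + 1 variables are counted as the sequences of n + 1
    exponents with sum N. *)
Lemma size_layer (R : realType) (H : hilbertType R) n m (T : 'I_n.+1 -> H -> H)
  (xi : 'I_m -> H) N : size (layer T xi N) = ('C(n + N, n) * m)%N.
Proof.
by rewrite size_allpairs size_map -cardE card_ord_partitions -cardE card_ord.
Qed.

(** * Uniform bounds on compressions and the trace *)

Section PositiveTraceClass.
Variables (R : realType) (H : hilbertType R).

Lemma quadratic_form_lipschitz (A : H -> H) : bounded_operator A ->
  exists2 K : R, 0 <= K & forall x y, rnorm x <= 1 -> rnorm y <= 1 ->
    complex.Re (hdot (A x) x) <= complex.Re (hdot (A y) y) + K * rnorm (x - y).
Proof.
move=> /bounded_operatorP[lA [K K0 AK]]; exists (K *+ 2); first by rewrite mulrn_wge0.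
move=> x y x1 y1.
have -> : hdot (A x) x = hdot (A y) y + (hdot (A x) (x - y) + hdot (A (x - y)) y).
  by rewrite (linear_funB lA) hdotBl hdotBr; ring.
rewrite raddfD lerD2l; apply: le_trans (ler_Re_cabs _) _.
apply: le_trans (cabsD _ _) _; rewrite mulrnAl mulr2n; apply: lerD.
  apply: le_trans (ler_cabs_hdot _ _) _; rewrite ler_wpM2r ?rnorm_ge0 //.
  by apply: le_trans (AK _) _; rewrite ler_piMr.
apply: le_trans (ler_cabs_hdot _ _) _; apply: le_trans (AK _).
by rewrite ler_piMr ?rnorm_ge0.
Qed.

(** The bound passes from the compressions to A since the vectors of s are limits of
    their projections and the form of A is Lipschitz on the unit ball. *)
Lemma orthonormal_trace_le d m (T : 'I_d -> H -> H) (xi : 'I_m -> H)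
    (A : H -> H) (C : R) s :
  bounded_operator A -> nonneg_operator A -> cyclic_family T xi ->
  (forall N, \sum_(f <- gram_schmidt (layers T xi N)) complex.Re (hdot (A f) f) <= C) ->
  orthonormal s -> \sum_(e <- s) complex.Re (hdot (A e) e) <= C.
Proof.
move=> bA A0 cxi trC os; have [K K0 AK] := quadratic_form_lipschitz bA.
apply/ler_addgt0Pr => e e0.
(* c leaves room for the size s approximation errors, each at most K * (e / c) *)
pose c : R := K * (size s)%:R + 1.
have c0 : 0 < c by rewrite ltr_wpDl // mulr_ge0.
have [N HN] := layer_proj_approx_seq s cxi (divr_gt0 e0 c0).
have oN := gram_schmidt_orthonormal (layers T xi N).
apply: le_trans (lerD (trC N) (lexx e)).
apply: le_trans (lerD (compression_trace_le (bounded_linear bA) A0 oN os) (lexx e)).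
apply: (@le_trans _ _ (\sum_(x <- s)
    (complex.Re (hdot (A (layer_proj T xi N x)) (layer_proj T xi N x))
           + K * (e / c)))).
  rewrite big_seq [leRHS]big_seq; apply: ler_sum => x xs.
  have x1 := orthonormal_rnorm os xs.
  apply: le_trans (AK x (layer_proj T xi N x) _ _) _; rewrite ?x1 //.
    by rewrite -x1 rnorm_proj_le.
  by rewrite lerD2l ler_wpM2l // ltW // HN.
rewrite big_split /= lerD2l big_const_seq count_predT iter_addr addr0.
rewrite -mulr_natr mulrAC mulrCA ler_piMr ?(ltW e0) // ler_pdivrMr // mul1r.
by rewrite /c lerDl.
Qed.

Lemma fsbig_orthonormal (E : set H) (F : set H) : orthonormal_basis E ->
  finite_set F -> F `<=` E -> orthonormal (finmap.enum_fset (fset_set F)).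
Proof.
move=> [E1 Eo _] finF FE.
have : {subset finmap.enum_fset (fset_set F) <= E}.
  by move=> x; rewrite -[x \in _]/(x \in fset_set F) in_fset_set // => /set_mem /FE /mem_set.
have : uniq (finmap.enum_fset (fset_set F)) by apply: finmap.fset_uniq.
elim: (finmap.enum_fset _) => //= e s IH /andP[es us] sub.
have eE : E e by exact/set_mem/sub/mem_head.
have sE : {subset s <= E} by move=> f fs; apply: sub; rewrite inE fs orbT.
split; [exact: E1| |exact: IH].
move=> f fs; apply: Eo => //; first exact/set_mem/sE.
by move=> ef; rewrite ef fs in es.
Qed.

(** A nonnegative operator is its own absolute value, so that both conclusions are
    about sums of its nonnegative diagonal coefficients.  The basis E0 is where the
    trace, which is defined through all the bases, is evaluated. *)
Lemma nonneg_trace_class_le (A : H -> H) (C : R) (E0 : set H) :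
  bounded_operator A -> nonneg_operator A -> orthonormal_basis E0 -> 0 <= C ->
  (forall s, orthonormal s -> \sum_(e <- s) complex.Re (hdot (A e) e) <= C) ->
  trace_class A /\ trace A <= C%:C.
Proof.
move=> bA A0 oE0 C0 trC; split.
  split=> //; exists A; split.
    by split=> // x; rewrite adj_selfadjoint.
  move=> E oE; apply: (@le_lt_trans _ _ C%:E); last exact: ltry.
  rewrite /esum; apply: ge_ereal_sup => _ [F [finF FE] <-].
  rewrite fsbig_finite //= sumEFin lee_fin; apply: trC.
  exact: fsbig_orthonormal FE.
(* the default value of the trace, 0, is bounded by C as well *)
rewrite /trace; case: xgetP => [t _ ht|_]; last by rewrite lecR.
have approx (e : R) : 0 < e -> exists2 r : R, r <= C & cabs (r%:C - t) < e.
  move=> e0; have e0' : 0 < e%:C by rewrite ltcR.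
  have [F [finF FE /(_ F finF FE (fun _ x => x))]] := ht _ oE0 _ e0'.
  rewrite fsbig_finite //=; set s := finmap.enum_fset _ => h.
  exists (\sum_(f <- s) complex.Re (hdot (A f) f)).
    by apply: trC; apply: fsbig_orthonormal FE.
  rewrite -ltcR -cabsE; apply: le_lt_trans h; rewrite rmorph_sum /=.
  rewrite (eq_bigr (fun f => hdot (A f) f)) // => f _.
  by rewrite RRe_real // ger0_real.
have Im_le (z : R[i]) : `|complex.Im z| <= cabs z.
  have := normc_ge_Re ('i * z); rewrite cabsE cabsM lecR.
  have -> : cabs 'i = 1 :> R by rewrite /cabs normc_def /= expr0n expr1n add0r sqrtr1.
  by rewrite mul1r; case: z => a b /=; rewrite mul0r mul1r sub0r normrN.
rewrite lecE /=; apply/andP; split.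
  rewrite eq_sym -normr_le0; apply/ler_addgt0Pl => e e0.
  have [r _ re] := approx e e0; rewrite addr0.
  apply: le_trans (ltW re); apply: le_trans (Im_le _).
  by case: t {ht approx re} => a b /=; rewrite sub0r normrN.
apply/ler_addgt0Pr => e e0; have [r rC re] := approx e e0.
have : complex.Re (t - r%:C) <= e.
  apply: le_trans (ler_Re_cabs _) _.
  by rewrite -opprB /cabs normrN ltW.
by case: t {ht approx re} => a b /=; lra.
Qed.

End PositiveTraceClass.

Theorem theorem4p7 (R : realType) (H : hilbertType R) (d m vartheta : nat)
    (Omega : set 'rV[(R[i])^o]_d) (T : 'I_d -> H -> H)
    (hd : (0 < d)%N)
    (hsep : separable_space H)
    (hOmega : bounded_domain Omega)
    (hconv : polynomially_convex (closure Omega))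
    (hT : forall i, bounded_operator (T i))
    (hcomm : commuting T)
    (hBS : BS_class m vartheta Omega T) :
  trace_class (dEt (commutator_block T)) /\
  trace (dEt (commutator_block T)) <=
    (m%:R * vartheta%:R * (d`!)%:R * \prod_(i < d) opnorm (T i) ^+ 2)%:C.
Proof.
have [_ _ _ [xi /= [cxi inv_perp A0 word_le]]] := hBS.
have bA : bounded_operator (dEt (commutator_block T)).
  by apply: dEt_bounded => i j; apply: commutator_block_bounded.
set C : R := (X in X%:C).
have Pi0 : 0 <= \prod_(i < d) opnorm (T i) ^+ 2.
  by apply: prodr_ge0 => i _; apply: sqr_ge0.
have C0 : 0 <= C by rewrite !mulr_ge0.
(* it suffices to bound the trace of each compression to the span of layers N *)
apply: (nonneg_trace_class_le bA A0 (layer_basis_orthonormal cxi) C0).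
move=> s; apply: (orthonormal_trace_le bA A0 cxi) => -[|N]; first by rewrite big_nil.
case: d hd T xi Omega hOmega hconv hT hcomm cxi hBS inv_perp A0 word_le bA @C Pi0 C0
  => // n _ T xi _ _ _ hT hcomm cxi _ inv_perp A0 word_le bA C Pi0 C0.
(* t is a basis of the orthogonal complement of the lower degrees *)
have [t gsE t_size] := gram_schmidt_cat (layer T xi N) (layers T xi N).
set r := gram_schmidt _.
have or : orthonormal r by apply: gram_schmidt_orthonormal.
have rE : r = t ++ gram_schmidt (layers T xi N) by [].
pose beta : R := vartheta%:R * 'C(N + n, n)%:R^-1 * \prod_(i < n.+1) opnorm (T i) ^+ 2.
have beta0 : 0 <= beta by rewrite !mulr_ge0.
have summand (tau : 'S_n.+1) : cabs (\sum_(f <- r) hdot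
     (alternating_word T tau (T (tau ord_max) f)
      - T (tau ord_max) (alternating_word T tau f)) f)
     <= (size t)%:R * beta.
  rewrite rE; apply: trace_compressed_commutator; rewrite -?rE //.
  - exact: alternating_word_bounded.
  - move=> x; have := inv_perp N (tau ord_max) x.
    by rewrite orthproj_filtration.
  - move=> f fs; apply: gram_schmidt_span.
    apply: (@linspan_sub _ _ [set` layers T xi N]
      (fun f => linspan [set` layers T xi N.+1] (T (tau ord_max) f))).
    + by rewrite (linear_fun0 (bounded_linear (hT _))); exact: linspan0.
    + by move=> x y; rewrite (linear_funD (bounded_linear (hT _))); exact: linspanD.
    + by move=> a x; rewrite (linear_funZ (bounded_linear (hT _))); exact: linspanZ.
    + by move=> x xl; apply: linspan_gen; apply: layers_shift.
    exact: gram_schmidt_sub.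
  - move=> x x1; have := word_le tau N ord_max erefl.
    rewrite orthproj_filtration addnS /=; apply: le_trans.
    apply: (@opnorm_ge _ _ (_ \o _) x) => //.
    have bQ := proj_bounded or.
    have bW := alternating_word_bounded tau hT.
    have bQp : bounded_operator (fun x => x - proj r x).
      exact: bounded_sub (bounded_id H) bQ.
    by do 4 (apply: bounded_comp => //).
have -> : \sum_(f <- r) complex.Re (hdot (dEt (commutator_block T) f) f)
  = complex.Re (\sum_(tau : 'S_n.+1) (-1) ^+ tau * \sum_(f <- r) hdot
     (alternating_word T tau (T (tau ord_max) f)
      - T (tau ord_max) (alternating_word T tau f)) f).
  rewrite -raddf_sum; congr complex.Re.
  under [RHS]eq_bigr do rewrite mulr_sumr.
  rewrite exchange_big /=; apply: eq_bigr => f _.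
  rewrite dEt_alternating_word // hdot_suml; apply: eq_bigr => tau _.
  by rewrite hdotZl.
rewrite raddf_sum /=.
apply: (@le_trans _ _ (\sum_(tau : 'S_n.+1)
    (m%:R * vartheta%:R * \prod_(i < n.+1) opnorm (T i) ^+ 2))).
  apply: ler_sum => tau _; apply: le_trans (ler_Re_cabs _) _.
  rewrite cabsM; have -> : cabs ((-1) ^+ tau : R[i]) = 1.
    by rewrite /cabs normrX normrN1 expr1n.
  rewrite mul1r; apply: le_trans (summand tau) _.
  apply: (@le_trans _ _ (('C(N + n, n) * m)%:R * beta)).
    by rewrite ler_wpM2r // ler_nat addnC -(size_layer T xi).
  rewrite /beta natrM le_eqVlt; apply/orP; left; apply/eqP; field.
  by rewrite pnatr_eq0 -lt0n bin_gt0 leq_addl.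
rewrite sumr_const card_Sn -[leLHS]mulr_natr /C.
by rewrite mulrAC.
Qed.
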